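(* Let $s\ge1$, $d\ge1$ and let $X_s=Z_1+\dots+Z_s+3Q\subset\mathbb P^2$ be a general union of $s$ 2-squares $Z_1,\dots,Z_s$ and a triple point $3Q$. If $(s,d)\ne(1,3)$ then $$\dim I(X_s)_d=\max\left\{\binom{d+2}{2}-4s-6,\ 0\right\}.$$ If $(s,d)=(1,3)$ then $\dim I(X_1)_3=1$ (whereas the expected value is $0$).
   Context: Work over $\mathbb C$; $S=\mathbb C[x,y,z]$, $S_d$ its degree-$d$ forms, $\dim S_d=\binom{d+2}{2}$. For a closed subscheme $X\subset\mathbb P^2$, $I(X)$ is its saturated homogeneous ideal, $I(X)_d=I(X)\cap S_d$. A 2-square supported at $P$ is the subscheme $Z$ with $I(Z)=(L_1^2,L_2^2)$, $L_1,L_2$ linearly independent linear forms vanishing at $P$ (length 4). $3Q$ is the triple (fat) point with ideal $I(Q)^3$ (length 6). $+$ denotes union of schemes with disjoint supports. ''General'' means the points $Q$, $P_1,\dots,P_s$ (supports of the $Z_i$) are general and the pairs of lines of each 2-square are general. *)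

(* Defs.v *)
From HB Require Import structures.
From mathcomp Require Import all_boot all_order all_algebra.
From mathcomp Require Import mpoly.
From mathcomp Require Import complex.
From mathcomp Require Import reals.
Set Implicit Arguments. Unset Strict Implicit. Unset Printing Implicit Defensive.
Import Order.TTheory GRing.Theory Num.Theory.
Local Open Scope ring_scope.

Notation CC R := (complex R).

Section PlaneCurves.
Variable R : realType.
Local Notation C := (CC R).
Local Notation S := {mpoly C[3]}.

Definition linform (a : 'I_3 -> C) : S := \sum_(i < 3) a i *: 'X_i.

Definition lin_indep2 (L1 L2 : S) : Prop :=
  forall a b : C, a *: L1 + b *: L2 = 0 -> a = 0 /\ b = 0.

Definition in_I_2square (L1 L2 : S) (F : S) : Prop :=
  exists G1 G2 : S, F = G1 * L1 ^+ 2 + G2 * L2 ^+ 2.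

(* I(Q): homogeneous ideal of the projective point Q = [q]; a polynomial lies in it
   iff all its homogeneous components vanish at q, i.e. F(t q) = 0 for all t *)
Definition in_I_point (q : 'I_3 -> C) (F : S) : Prop :=
  forall t : C, F.@[fun i => t * q i] = 0.

Definition in_I_triple (q : 'I_3 -> C) (F : S) : Prop :=
  exists (k : nat) (A B D : 'I_k -> S),
    (forall j, in_I_point q (A j) /\ in_I_point q (B j) /\ in_I_point q (D j)) /\
    F = \sum_(j < k) A j * B j * D j.

Definition has_dim (V : S -> Prop) (n : nat) : Prop :=
  exists B : 'I_n -> S,
    (forall i, V (B i)) /\
    (forall c : 'I_n -> C, \sum_(i < n) c i *: B i = 0 -> forall i, c i = 0) /\
    (forall F, V F -> exists c : 'I_n -> C, F = \sum_(i < n) c i *: B i).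

(* Parameters: a vector v in C^(6s+3).  Coordinates 6i..6i+2 and 6i+3..6i+5
   (i < s) are the coefficients of the two linear forms L_{1,i}, L_{2,i}
   defining the 2-square Z_i (ideal (L_{1,i}^2, L_{2,i}^2), supported at the
   point L_{1,i} = L_{2,i} = 0); coordinates 6s..6s+2 are the point Q. *)
Definition vget n (v : 'I_n -> C) (k : nat) : C :=
  if insub k is Some i then v i else 0.

Definition L1of n (v : 'I_n -> C) (i : nat) : S :=
  linform (fun j : 'I_3 => vget v (6 * i + j)).
Definition L2of n (v : 'I_n -> C) (i : nat) : S :=
  linform (fun j : 'I_3 => vget v (6 * i + 3 + j)).
Definition Qof (s : nat) n (v : 'I_n -> C) : 'I_3 -> C :=
  fun j => vget v (6 * s + j).

(* I(X_s)_d for X_s = Z_1 + ... + Z_s + 3Q (supports disjoint, so the saturated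
   ideal of the union is the intersection of the ideals) *)
Definition IX_d (s d : nat) n (v : 'I_n -> C) (F : S) : Prop :=
  F \is d.-homog /\
  (forall i, (i < s)%N -> in_I_2square (L1of v i) (L2of v i) F) /\
  in_I_triple (Qof s v) F.

Definition general_prop n (P : ('I_n -> C) -> Prop) : Prop :=
  exists H : {mpoly C[n]}, H != 0 /\ forall v : 'I_n -> C, H.@[v] != 0 -> P v.

End PlaneCurves.

(* Main.v *)
Require Import Defs.
From HB Require Import structures.
From mathcomp Require Import all_boot all_order all_algebra.
From mathcomp Require Import mpoly complex reals.
From mathcomp Require Import ring zify.
Set Implicit Arguments. Unset Strict Implicit. Unset Printing Implicit Defensive.
Import Order.TTheory GRing.Theory Num.Theory.
Local Open Scope ring_scope.

(* Membership in I(X_s)_d amounts to 4s + 6 linear conditions whose coefficients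
   are polynomials in the parameters, so by semicontinuity of the rank it is enough
   to find one configuration where they have maximal rank.  Take Q = [0 : 0 : 1] and
   let Z_k be given by (X - p_k Z)^2 and (Y - q_k Z)^2.  The triple point leaves the
   monomials X^i Y^j Z^(d-i-j) with 3 <= i + j <= d, and Z_k imposes on them the
   conditions with coefficients p_k^i q_k^j times 1, i, j, ij.  Letting the points
   tend to the boundary of the torus one after the other, each at the rate given by
   a weight on the lattice points (i, j), the leading term of a minor becomes a
   product of determinants of the vectors (1, i, j, ij) over disjoint sets of four
   lattice points.  The trapezoid 3 <= i + j <= d is exhausted layer by layer from
   i + j = d downwards, always by sets of four with nonzero determinant; this works
   for d >= 4.  The only obstruction is the layer i + j = 3 on its own: for
   (s, d) = (1, 3) the tripled line PQ is an unexpected cubic. *)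

(** * Ranks and degenerations *)

Section RankGe.
Variables (K : fieldType) (T : eqType).
Implicit Types (D : seq T) (Y : (T -> K) -> Prop).

(** A pair of biorthogonal families certifies the rank of [Y] restricted to [D]; in this form [D]
    can be permuted and enlarged without indexing matrices by its points. *)
Definition rank_ge D Y (r : nat) :=
  exists u x : 'I_r -> T -> K, (forall i, Y (u i)) /\
    forall i j, \sum_(m <- D) u i m * x j m = (i == j)%:R.

Definition lin_closed Y :=
  [/\ forall y z, y =1 z -> Y y -> Y z, Y (fun=> 0)
    & forall c y z, Y y -> Y z -> Y (fun m => c * y m + z m)].

Lemma lin_closed_sum Y n (c : 'I_n -> K) (y : 'I_n -> T -> K) :
  lin_closed Y -> (forall i, Y (y i)) -> Y (fun m => \sum_i c i * y i m).
Proof.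
case=> Yext Y0 YD; elim: n c y => [|n IH] c y Yy.
  by apply: Yext Y0 => m; rewrite big_ord0.
apply: (Yext (fun m => c ord0 * y ord0 m
    + \sum_i c (lift ord0 i) * y (lift ord0 i) m)) => [m|].
  by rewrite big_ord_recl.
by apply: YD => //; apply: (IH (fun i => c (lift ord0 i))
  (fun i => y (lift ord0 i))) => i; apply: Yy.
Qed.

Lemma rank_ge_perm D1 D2 Y r : perm_eq D1 D2 -> rank_ge D1 Y r -> rank_ge D2 Y r.
Proof.
move=> eqD [u [x [Yu ux]]]; exists u, x; split=> // i j.
by rewrite -ux; apply/esym/perm_big.
Qed.

Lemma rank_ge0 D Y : rank_ge D Y 0.
Proof. by exists (fun _ _ => 0), (fun _ _ => 0); split=> -[]. Qed.

(** Combining the [u i] with the coefficients of the inverse Gram matrix makes the two families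
    biorthogonal. *)
Lemma rank_ge_det D Y r (u x : 'I_r -> T -> K) :
  lin_closed Y -> (forall i, Y (u i)) ->
  \det (\matrix_(i, j) \sum_(m <- D) u i m * x j m) != 0 -> rank_ge D Y r.
Proof.
move=> Yl Yu; set A := \matrix_(_, _) _ => dA.
have uA : A \in unitmx by rewrite unitmxE unitfE.
exists (fun i m => \sum_j invmx A i j * u j m), x.
split=> [i|i j]; first exact: lin_closed_sum.
have := mulVmx uA => /matrixP/(_ i j); rewrite !mxE => <-.
under eq_bigr do rewrite mulr_suml.
rewrite exchange_big /=; apply: eq_bigr => k _; rewrite mxE mulr_sumr.
by apply: eq_bigr => m _; rewrite mulrA.
Qed.

(* The Gram matrix of the enlarged system is [P Q; S 1]; [h] encodes S in such a
   way that the hypothesis is the invertibility of the Schur complement P - QS. *)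
Lemma rank_ge_extend D Y r b (B : b.-tuple T) : uniq (B ++ D) -> rank_ge D Y r ->
  exists h : T -> 'I_b -> K, forall Y' (z : 'I_b -> T -> K),
    lin_closed Y' -> (forall y, Y y -> Y' y) -> (forall a, Y' (z a)) ->
    \det (\matrix_(a, j) (z a (tnth B j) - \sum_(m <- D) z a m * h m j)) != 0 ->
    rank_ge (B ++ D) Y' (b + r).
Proof.
rewrite cat_uniq => /and3P[uB /hasPn BD uD] [u [x [Yu ux]]].
exists (fun m j => \sum_i x i m * u i (tnth B j)) => Y' z Yl YY' Yz dz.
pose row k := match split k with inl a => z a | inr i => u i end.
(* The new test vectors are indicators of the points of [B]; the old ones are cut off outside [D],
   so the lower right block stays the identity. *)
pose col k m := match split k with
  | inl a => (m == tnth B a)%:R | inr i => (m \in D)%:R * x i m end : K.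
apply: (@rank_ge_det _ _ _ row col) => //.
  by move=> i; rewrite /row; case: split => // k; apply: YY'.
have notD j : tnth B j \notin D.
  by apply/negP => /BD; rewrite mem_tnth.
have colB (f : T -> K) (j : 'I_b) : \sum_(m <- B ++ D) f m * (m == tnth B j)%:R
    = f (tnth B j).
  rewrite big_cat /= [X in _ + X]big1_seq ?addr0; last first.
    move=> m /andP[_ mD]; case: eqP => [e|]; rewrite ?mulr0 //.
    by move: (notD j); rewrite -e mD.
  rewrite big_tuple (bigD1 j) //= eqxx mulr1 big1 ?addr0 // => i ij.
  by rewrite (inj_eq (tuple_uniqP _ uB)) (negPf ij) mulr0.
have colD (f : T -> K) (i : 'I_r) :
    \sum_(m <- B ++ D) f m * ((m \in D)%:R * x i m) = \sum_(m <- D) f m * x i m.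
  rewrite big_cat /= big_tuple big1 ?add0r.
    by apply: eq_big_seq => m ->; rewrite mul1r.
  by move=> j _; rewrite (negPf (notD j)) mul0r mulr0.
set P := \matrix_(a, j) z a (tnth B j) : 'M_b.
set Q := \matrix_(a, j) \sum_(m <- D) z a m * x j m : 'M_(b, r).
set S := \matrix_(i, j) u i (tnth B j) : 'M_(r, b).
have -> : \matrix_(i, j) \sum_(m <- B ++ D) row i m * col j m
    = block_mx P Q S 1%:M.
  rewrite -[LHS]submxK; congr block_mx; apply/matrixP => i j;
    rewrite !mxE /row /col ?(unsplitK (inl _)) ?(unsplitK (inr _)) ?colB ?colD //.
(* Column operations clear the block S and leave P - QS as the upper left block of a triangular
   matrix. *)
have := det_mulmx (block_mx P Q S 1%:M) (block_mx 1%:M 0 (- S) 1%:M).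
rewrite mulmx_block !mulmx1 !mulmx0 mul1mx subrr !add0r mulmxN.
rewrite det_lblock det_ublock !det1 !mulr1 => <-.
rewrite (_ : P - Q *m S = \matrix_(a, j) (z a (tnth B j)
   - \sum_(m <- D) z a m * \sum_i x i m * u i (tnth B j))) //.
apply/matrixP => a j; rewrite !mxE; congr (_ - _).
under eq_bigr do rewrite !mxE mulr_suml.
rewrite exchange_big; apply: eq_bigr => m _; rewrite mulr_sumr.
by apply: eq_bigr => i _; rewrite mulrA.
Qed.

End RankGe.

(** The integers 1, ..., [size p] are distinct and nonzero in characteristic 0, and they are too
    many to be all roots. *)
Lemma poly_neq0_eval (K : numFieldType) (p : {poly K}) :
  p != 0 -> exists2 t, t != 0 & p.[t] != 0.
Proof.
move=> p0; pose s := [seq n.+1%:R : K | n <- iota 0 (size p)].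
have us : uniq s by rewrite map_inj_uniq ?iota_uniq // => m n /eqP; rewrite eqr_nat => /eqP[].
have /allPn[t /mapP[n _ ->] pt] : ~~ all (root p) s.
  apply/negP => /max_poly_roots /(_ us); rewrite size_map size_iota ltnn.
  by move/(_ p0).
by exists n.+1%:R => //; rewrite pnatr_eq0.
Qed.

(* Dividing row [a] by [t ^ rho a] and column [j] by [t ^ kap j] leaves a matrix
   of polynomials in t whose value at t = 0 is invertible. *)
Lemma det_leading_term (K : numFieldType) (T : eqType) b (B : b.-tuple T)
    (D : seq T) (g : 'I_b -> T -> K) (h : T -> 'I_b -> K)
    (w : T -> nat) (rho kap : 'I_b -> nat) :
  (forall a j, g a (tnth B j) != 0 -> (rho a + kap j <= w (tnth B j))%N) ->
  (forall a j m, m \in D -> g a m != 0 -> (rho a + kap j < w m)%N) ->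
  (forall x : 'I_b -> K, (forall j, \sum_a x a *
      (g a (tnth B j) *+ (w (tnth B j) == rho a + kap j)%N) = 0) ->
    forall a, x a = 0) ->
  exists2 t, t != 0 & \det (\matrix_(a, j) (g a (tnth B j) * t ^+ w (tnth B j)
    - \sum_(m <- D) g a m * t ^+ w m * h m j)) != 0.
Proof.
move=> gB gD inj.
pose e a j m := (w m - (rho a + kap j))%N.
pose N := \matrix_(a, j) ((g a (tnth B j))%:P * 'X^(e a j (tnth B j))
  - \sum_(m <- D) (g a m * h m j)%:P * 'X^(e a j m)) : 'M[{poly K}]_b.
have Nt t : (\det N).[t] = \det (\matrix_(a, j)
    (g a (tnth B j) * t ^+ e a j (tnth B j)
     - \sum_(m <- D) (g a m * h m j) * t ^+ e a j m)).
  rewrite -[LHS]/(horner_eval t (\det N)) -det_map_mx; congr (\det _).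
  apply/matrixP => a j; rewrite !mxE /= /horner_eval hornerD hornerN horner_sum.
  rewrite !hornerE; congr (_ - _).
  by apply: eq_bigr => m _; rewrite !hornerE.
have /poly_neq0_eval[t t0 Nt0] : \det N != 0.
  suff: (\det N).[0] != 0 by apply: contraNneq => ->; rewrite horner0.
  rewrite Nt; apply/negP => /det0P[v v0 vN]; case/negP: v0; apply/eqP/rowP => a.
  rewrite mxE; apply: (inj (v 0)) => j.
  move/rowP: vN => /(_ j); rewrite [LHS]mxE [RHS]mxE; apply: etrans.
  (* At t = 0 the terms over [D] disappear, their exponents being positive, and an entry over [B]
     survives exactly when its exponent is 0. *)
  apply: eq_bigr => {}a _; rewrite mxE big1_seq ?subr0 => [|m /andP[_ mD]].
    congr (_ * _); have [->|/gB le] := eqVneq (g a (tnth B j)) 0.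
      by rewrite mul0r mul0rn.
    rewrite expr0n /e subn_eq0 eqn_leq le andbT.
    by case: leqP; rewrite ?mulr1 ?mulr0.
  have [->|/(gD _ j _ mD) lt] := eqVneq (g a m) 0; first by rewrite !mul0r.
  by rewrite expr0n subn_eq0 leqNgt lt mulr0.
exists t => //.
rewrite (_ : \matrix_(a, j) _ = diag_mx (\row_a t ^+ rho a) *m
   (\matrix_(a, j) (g a (tnth B j) * t ^+ e a j (tnth B j)
     - \sum_(m <- D) (g a m * h m j) * t ^+ e a j m)) *m diag_mx (\row_j t ^+ kap j)).
  rewrite !det_mulmx !det_diag -Nt !mulf_neq0 //; apply/prodf_neq0 => i _;
    by rewrite mxE expf_neq0.
apply/matrixP => a j; rewrite mul_mx_diag mxE mul_diag_mx !mxE.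
rewrite mulrAC -exprD mulrBr; congr (_ - _).
  have [->|/gB le] := eqVneq (g a (tnth B j)) 0; first by rewrite !mul0r mulr0.
  by rewrite mulrCA -exprD subnKC.
rewrite mulr_sumr; apply: eq_big_seq => m mD.
have [->|/(gD _ j _ mD)/ltnW le] := eqVneq (g a m) 0; first by rewrite !mul0r mulr0.
by rewrite mulrCA -exprD subnKC // mulrAC.
Qed.

(** * Conditions of 2-squares on lattice points *)

Section Jets.
Variable K : numFieldType.
Implicit Types (m : nat * nat) (D : seq (nat * nat)).

Definition jet (c : nat) m : K :=
  nth 0 [:: 1; m.1%:R; m.2%:R; m.1%:R * m.2%:R] c.

(** Values at (p_k, q_k) of x^i y^j under 1, x d/dx, y d/dy and the product of these two. Monomials
    are eigenvectors of these operators, so the point enters only through the factor p_k^i q_k^j. *)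
Definition jets (p q : nat -> K) s (y : nat * nat -> K) :=
  exists e : nat -> nat -> K, forall m,
    y m = \sum_(k < s) \sum_(c < 4) e k c * (jet c m * p k ^+ m.1 * q k ^+ m.2).

Lemma jets_lin_closed p q s : lin_closed (jets p q s).
Proof.
split=> [y z yz [e ye]||c y z [e ye] [f zf]].
- by exists e => m; rewrite -yz ye.
- by exists (fun _ _ => 0) => m; rewrite big1 // => k _; rewrite big1 // => i _; rewrite mul0r.
exists (fun k i => c * e k i + f k i) => m.
rewrite ye zf mulr_sumr -big_split; apply: eq_bigr => k _.
rewrite mulr_sumr -big_split; apply: eq_bigr => i _ /=.
by rewrite mulrDl !mulrA.
Qed.

(** Points off the axes: [q 0] nonzero will later keep Q off a line of the first 2-square, as the
    cubic of the exceptional case requires. *)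
Definition jets_rank_ge D s r := exists p q : nat -> K,
  (forall k, p k != 0 /\ q k != 0) /\ rank_ge D (jets p q s) r.

Definition max_rank D := forall s, jets_rank_ge D s (minn (4 * s) (size D)).

Lemma jets_rank_ge0 D s : jets_rank_ge D s 0.
Proof.
exists (fun=> 1), (fun=> 1); split; last exact: rank_ge0.
by move=> k; rewrite oner_neq0.
Qed.

Lemma jets_rank_ge_perm D D' s r :
  perm_eq D D' -> jets_rank_ge D s r -> jets_rank_ge D' s r.
Proof.
by move=> DD' [p [q [pq rk]]]; exists p, q; split=> //; apply: rank_ge_perm rk.
Qed.

Lemma max_rank_perm D D' : perm_eq D D' -> max_rank D -> max_rank D'.
Proof.
move=> DD' mD s; rewrite -(perm_size DD'); exact: jets_rank_ge_perm (mD s).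
Qed.

(* For the point (p, q) = (t / t^N, 1 / t^N) the values t^(N k) p^i q^j are
   t^(weight N k (i, j)): small weights first exhaust the layer i + j = k, from
   small i to large i, then the layer i + j = k - 1, and so on. *)
Definition weight N k m := (N * (k - (m.1 + m.2)) + m.1)%N.

(** One more 2-square adds the rows [g a], evaluated at a point depending on t, and the Schur
    complement of [rank_ge_extend] has the shape treated in [det_leading_term]. The potentials [rho]
    and [kap] certify that the leading term comes from [B]; the entries attaining the bound form the
    leading matrix. *)
Lemma jets_rank_ge_peel b (B : b.-tuple (nat * nat)) D s r N k
    (g : 'I_b -> nat * nat -> K) (rho kap : 'I_b -> nat) :
  uniq (B ++ D) -> (forall m : nat * nat, m \in B ++ D -> (m.1 + m.2 <= k)%N) ->
  (forall a, exists e : nat -> K, forall m, g a m = \sum_(c < 4) e c * jet c m) ->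
  (forall a j, g a (tnth B j) != 0 -> (rho a + kap j <= weight N k (tnth B j))%N) ->
  (forall a j (m : nat * nat), m \in D -> g a m != 0 -> (rho a + kap j < weight N k m)%N) ->
  (forall x : 'I_b -> K, (forall j, \sum_a x a *
      (g a (tnth B j) *+ (weight N k (tnth B j) == rho a + kap j)%N) = 0) ->
    forall a, x a = 0) ->
  jets_rank_ge D s r -> jets_rank_ge (B ++ D) s.+1 (b + r).
Proof.
move=> uBD lek gjet gB gD inj [p [q [pq rk]]].
have [h hP] := rank_ge_extend uBD rk.
have [t t0 dt] := det_leading_term h gB gD inj.
pose p' i := if i == s then t * t ^- N else p i.
pose q' i := if i == s then t ^- N else q i.
(* The factor [t ^ (N * k)] clears the negative powers of t, since i + j <= k at all points. *)
pose z a m := g a m * (t ^+ (N * k) * (p' s ^+ m.1 * q' s ^+ m.2)).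
have zE a m : m \in B ++ D -> z a m = g a m * t ^+ weight N k m.
  move=> /lek mk; rewrite /z /p' /q' eqxx; congr (_ * _).
  rewrite exprMn -[_ * _ * t ^- N ^+ _]mulrA -exprD /weight [RHS]exprD.
  have -> : (N * k = N * (k - (m.1 + m.2)) + N * (m.1 + m.2))%N.
    by rewrite -mulnDr subnK.
  rewrite [t ^+ (_ + _)]exprD -mulrA; congr (_ * _).
  by rewrite mulrCA exprVn -exprM divff ?mulr1 ?expf_neq0.
exists p', q'; split=> [i|].
  rewrite /p' /q'; case: (i =P s) => _; last exact: pq.
  by split; rewrite ?mulf_neq0 ?invr_neq0 ?expf_neq0.
have sub y : jets p q s y -> jets p' q' s.+1 y.
  case=> e ye; exists (fun i c => if i == s then 0 else e i c) => m.
  rewrite ye big_ord_recr /= eqxx [X in _ + X]big1 ?addr0; last by move=> c _; rewrite mul0r.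
  by apply: eq_bigr => i _; rewrite /p' /q' !ltn_eqF.
apply: (hP _ z) => //; first exact: jets_lin_closed.
  move=> a; have [e ge] := gjet a.
  exists (fun i c => if i == s then e c * t ^+ (N * k) else 0) => m.
  rewrite big_ord_recr /= big1 ?add0r => [|i _]; last first.
    by rewrite big1 // => c _; rewrite ltn_eqF // mul0r.
  rewrite /z ge mulr_suml; apply: eq_bigr => c _; rewrite eqxx.
  by rewrite !mulrA; congr (_ * _ * _); rewrite mulrAC.
move: dt; congr (\det _ != 0); apply/matrixP => a j; rewrite !mxE.
rewrite zE ?mem_cat ?mem_tnth //; congr (_ - _); apply: eq_big_seq => m mD.
by rewrite zE // mem_cat mD orbT.
Qed.

Lemma max_rank_peel4 (B : 4.-tuple (nat * nat)) D :
  (forall s r, jets_rank_ge D s r -> jets_rank_ge (B ++ D) s.+1 (4 + r)) ->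
  max_rank D -> max_rank (B ++ D).
Proof.
move=> peel mD [|s]; first by rewrite muln0 min0n; apply: jets_rank_ge0.
rewrite size_cat size_tuple mulnS -addn_minr; exact: peel.
Qed.

(** The [a] points of the layer i + j = k with the largest i: what is left of a layer that is
    exhausted from small i upwards. *)
Definition seg k a := [seq (i, k - i)%N | i <- iota (k.+1 - a) a].

Lemma mem_seg k a m : (a <= k.+1)%N ->
  (m \in seg k a) = (k.+1 - a <= m.1)%N && (m.1 + m.2 == k)%N.
Proof.
move=> ak; case: m => i j /=; apply/mapP/idP => [[x + [-> ->]]|].
  rewrite mem_iota => ?; lia.
by move=> ij; exists i; [rewrite mem_iota; lia | congr (_, _); lia].
Qed.

Lemma seg_uniq k a : uniq (seg k a).
Proof. by rewrite map_inj_uniq ?iota_uniq // => x y []. Qed.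

Lemma size_seg k a : size (seg k a) = a.
Proof. by rewrite size_map size_iota. Qed.

Lemma segS k a : (a <= k)%N -> seg k a.+1 = (k - a, a)%N :: seg k a.
Proof.
move=> ak; rewrite /seg /= subSS subKn //; congr (_ :: map _ (iota _ _)).
by rewrite subSn.
Qed.

Lemma segs_uniq k a b (D : seq (nat * nat)) : (a <= k.+2)%N -> (b <= k.+1)%N -> uniq D ->
  (forall m : nat * nat, m \in D -> (m.1 + m.2 < k)%N) -> uniq (seg k.+1 a ++ seg k b ++ D).
Proof.
move=> ak bk uD Dk; rewrite !cat_uniq !seg_uniq uD /= andbT; apply/andP; split.
  apply/hasPn => m; rewrite mem_cat !mem_seg // => /orP[|/Dk]; lia.
by apply/hasPn => m /Dk; rewrite mem_seg //; lia.
Qed.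

Lemma weight_ge N k l m : (m.1 + m.2 + l <= k)%N -> (N * l + m.1 <= weight N k m)%N.
Proof. by move=> ml; rewrite /weight leq_add2r leq_mul2l; lia. Qed.

Lemma weight_eq N k l m : (m.1 + m.2 + l = k)%N -> weight N k m = (N * l + m.1)%N.
Proof. by move=> <-; rewrite /weight addKn. Qed.

End Jets.

(** * Exhausting the lattice points *)

Section Peels.
Variable K : numFieldType.
Local Notation max_rank := (@max_rank K).

Lemma sum_ord4 (F : 'I_4 -> K) : \sum_i F i =
  F (@Ordinal 4 0 isT) + F (@Ordinal 4 1 isT) + F (@Ordinal 4 2 isT) + F (@Ordinal 4 3 isT).
Proof.
rewrite !big_ord_recl big_ord0 addr0 !addrA.
by congr (F _ + F _ + F _ + F _); apply/val_inj.
Qed.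

Lemma forall_ord4 (P : 'I_4 -> Prop) : P (@Ordinal 4 0 isT) -> P (@Ordinal 4 1 isT) ->
  P (@Ordinal 4 2 isT) -> P (@Ordinal 4 3 isT) -> forall i, P i.
Proof.
move=> P0 P1 P2 P3 [[|[|[|[|//]]]] lti].
- by move: P0; congr P; apply/val_inj.
- by move: P1; congr P; apply/val_inj.
- by move: P2; congr P; apply/val_inj.
- by move: P3; congr P; apply/val_inj.
Qed.

(** The second difference isolates [2 * x2], and then the first difference isolates [x1]. *)
Lemma quadratic_eq0 (x0 x1 x2 u : K) :
  x0 + x1 * u + x2 * u ^+ 2 = 0 ->
  x0 + x1 * (u + 1) + x2 * (u + 1) ^+ 2 = 0 ->
  x0 + x1 * (u + 2) + x2 * (u + 2) ^+ 2 = 0 -> [/\ x0 = 0, x1 = 0 & x2 = 0].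
Proof.
pose s y := x0 + x1 * y + x2 * y ^+ 2.
rewrite -/(s u) -/(s (u + 1)) -/(s (u + 2)) => e0 e1 e2.
have n2 : (2 : K) != 0 by rewrite pnatr_eq0.
have x20 : x2 = 0.
  apply: (mulfI n2); rewrite mulr0 (_ : 2 * x2 = s (u + 2) - 2 * s (u + 1) + s u).
    by rewrite e0 e1 e2; ring.
  by rewrite /s; ring.
have x10 : x1 = 0.
  rewrite (_ : x1 = s (u + 1) - s u - x2 * (2 * u + 1)); last by rewrite /s; ring.
  by rewrite e0 e1 x20; ring.
split=> //; rewrite (_ : x0 = s u - x1 * u - x2 * u ^+ 2); last by rewrite /s; ring.
by rewrite e0 x10 x20; ring.
Qed.

(* The condition i + j - (k + 2) vanishes on the top layer, so the points of that
   layer which [b3] overtakes do not enter the leading term. *)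
Lemma max_rank_peel31 k a n D :
  (a <= k)%N -> (n <= k.+1)%N -> uniq D ->
  (forall m : nat * nat, m \in D -> (m.1 + m.2 < k.+1)%N) ->
  max_rank (seg k.+2 a ++ seg k.+1 n ++ D) ->
  max_rank (seg k.+2 a.+3 ++ seg k.+1 n.+1 ++ D).
Proof.
move=> ak nk uD Dk.
pose b0 := (k.+2 - a.+2, a.+2)%N; pose b1 := (k.+2 - a.+1, a.+1)%N.
pose b2 := (k.+2 - a, a)%N; pose b3 := (k.+1 - n, n)%N.
have eqD : perm_eq ([tuple b0; b1; b2; b3] ++ seg k.+2 a ++ seg k.+1 n ++ D)
    (seg k.+2 a.+3 ++ seg k.+1 n.+1 ++ D).
  rewrite !segS; try lia; rewrite /= -/b0 -/b1 -/b2 -/b3 !perm_cons.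
  by rewrite -cat1s -[seg _ a ++ _ :: _]/(seg _ a ++ [:: b3] ++ _) perm_catCA.
move=> mD; apply: (max_rank_perm eqD); apply: max_rank_peel4 mD => s r.
(* [N] exceeds the first coordinates of all these points, so the weights of one layer lie below
   those of the next. *)
pose N := k.+4.
have Dlay (m : nat * nat) : m \in seg k.+2 a ++ seg k.+1 n ++ D ->
  [\/ weight N k.+2 m = m.1 /\ (m.1 + m.2 = k.+2 /\ k.+2 - a < m.1)%N,
      weight N k.+2 m = (N + m.1)%N /\ (k.+1 - n < m.1)%N
    | (2 * N <= weight N k.+2 m)%N].
  rewrite !mem_cat !mem_seg; try lia; case/or3P.
  - move=> /andP[am /eqP mk]; constructor 1; rewrite (@weight_eq _ _ 0) ?addn0 // muln0.
    by do !split => //; lia.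
  - move=> /andP[am /eqP mk]; constructor 2.
    by rewrite (@weight_eq _ _ 1) ?muln1 ?addn1 ?mk //; split=> //; lia.
  - move=> /Dk mk; constructor 3; have := @weight_ge N k.+2 2 m; lia.
have wb0 : weight N k.+2 b0 = (k.+2 - a.+2)%N by rewrite (@weight_eq _ _ 0) /=; lia.
have wb1 : weight N k.+2 b1 = (k.+2 - a.+1)%N by rewrite (@weight_eq _ _ 0) /=; lia.
have wb2 : weight N k.+2 b2 = (k.+2 - a)%N by rewrite (@weight_eq _ _ 0) /=; lia.
have wb3 : weight N k.+2 b3 = (N + (k.+1 - n))%N by rewrite (@weight_eq _ _ 1) /=; lia.
pose g (i : 'I_4) m : K :=
  nth 0 [:: 1; m.1%:R; m.1%:R * m.2%:R; m.1%:R + m.2%:R - k.+2%:R] i.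
(* The first three rows attain the bound at [b0], [b1], [b2], and the last one at [b3]. The column
   shift of [b3] is that of [b2], which is below the weight of every remaining point. *)
pose rho (i : 'I_4) := nth 0%N [:: 0; 0; 0; N + (k.+1 - n) - (k.+2 - a)]%N i.
pose kap (j : 'I_4) := nth 0%N [:: k.+2 - a.+2; k.+2 - a.+1; k.+2 - a; k.+2 - a]%N j.
have g3 i j : (i + j = k.+2)%N -> i%:R + j%:R - k.+2%:R = 0 :> K.
  by move=> <-; rewrite natrD subrr.
apply: (@jets_rank_ge_peel _ _ _ _ _ _ N k.+2 g rho kap).
- by rewrite (perm_uniq eqD) segs_uniq //; lia.
- move=> m; rewrite (perm_mem eqD) !mem_cat !mem_seg; try lia.
  case/or3P => [|| /Dk]; lia.
- move=> i; exists (fun c => nth 0 (nth [::] [:: [:: 1; 0; 0; 0]; [:: 0; 1; 0; 0];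
     [:: 0; 0; 0; 1]; [:: - k.+2%:R; 1; 1; 0]] i) c) => m.
  rewrite !big_ord_recl big_ord0 /jet /g.
  by case: i => -[|[|[|[|//]]]] ? /=; ring.
- move=> [[|[|[|[|//]]]] hi] [[|[|[|[|//]]]] hj];
    rewrite /g /rho /kap !(tnth_nth (0, 0)%N) /= ?wb0 ?wb1 ?wb2 ?wb3;
    try lia; try by rewrite g3 ?eqxx //=; lia.
- move=> i j m /Dlay Dm; have kj : (k - a <= kap j <= k.+2 - a)%N.
    by rewrite /kap; case: j => -[|[|[|[|//]]]] ? /=; lia.
  rewrite /g /rho; case: Dm => [[-> [lm la]]|[-> ln]|lw].
  + by case: i => -[|[|[|[|//]]]] ? /=; rewrite ?g3 ?eqxx //; lia.
  + by case: i => -[|[|[|[|//]]]] ? /= _; rewrite /N; lia.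
  + by case: i => -[|[|[|[|//]]]] ? /= _; rewrite /N in lw *; lia.
move=> x xg.
have x0 := xg (@Ordinal 4 0 isT); have x1 := xg (@Ordinal 4 1 isT).
have x2 := xg (@Ordinal 4 2 isT); have x3 := xg (@Ordinal 4 3 isT).
move: x0 x1 x2 x3; rewrite !sum_ord4 /g /rho /kap !(tnth_nth (0, 0)%N) /= wb0 wb1 wb2 wb3.
rewrite (g3 (k.+2 - a.+2)%N a.+2) ?(g3 (k.+2 - a.+1)%N a.+1) ?(g3 (k.+2 - a)%N a); try lia.
have -> : (N + (k.+1 - n) - (k.+2 - a) + (k.+2 - a) = N + (k.+1 - n))%N by rewrite subnK; lia.
have -> : (N + (k.+1 - n) == k.+2 - a)%N = false by apply/eqP; lia.
rewrite !eqxx !mul0rn !mulr0n !mulr1n !mulr0 !addr0 !add0r !mulr1.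
pose u : K := (k.+2 - a.+2)%:R; pose l : K := k.+2%:R.
have -> : (k.+2 - a.+1)%:R = u + 1 :> K by rewrite natr1; congr _%:R; lia.
have -> : (k.+2 - a)%:R = u + 2 :> K by rewrite -natrD; congr _%:R; lia.
have -> : a.+2%:R = l - u :> K by rewrite -natrB ?leq_subr //; congr _%:R; lia.
have -> : a.+1%:R = l - (u + 1) :> K by rewrite natr1 -natrB; [congr _%:R|]; lia.
have -> : a%:R = l - (u + 2) :> K by rewrite -natrD -natrB; [congr _%:R|]; lia.
rewrite -/u; set x0 := x _; set x1 := x _; set x2 := x _ => e0 e1 e2.
rewrite -natrD subnK; last by lia.
rewrite -[k.+2%:R]natr1 opprD addrA subrr add0r mulrN1 => /eqP; rewrite oppr_eq0 => /eqP x3.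
(* On i + j = l the functions 1, i, ij combine to a quadratic in i, which vanishes at the three
   consecutive values u, u + 1, u + 2. *)
have [] := @quadratic_eq0 x0 (x1 + x2 * l) (- x2) u.
- by rewrite -[RHS]e0; ring.
- by rewrite -[RHS]e1; ring.
- by rewrite -[RHS]e2; ring.
move=> x00 x10 /eqP; rewrite oppr_eq0 => /eqP x20.
by apply: forall_ord4 => //; move: x10; rewrite x20 mul0r addr0.
Qed.

(** If every point of [B] is lighter than every point of [D], the weights themselves serve as column
    shifts, and the leading matrix is the full matrix of the [g a] on [B]. *)
Lemma jets_rank_ge_peel_first b (B : b.-tuple (nat * nat)) D s r N k
    (g : 'I_b -> nat * nat -> K) :
  uniq (B ++ D) -> (forall m : nat * nat, m \in B ++ D -> (m.1 + m.2 <= k)%N) ->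
  (forall a, exists e : nat -> K, forall m, g a m = \sum_(c < 4) e c * jet K c m) ->
  (forall j m, m \in D -> (weight N k (tnth B j) < weight N k m)%N) ->
  (forall x : 'I_b -> K, (forall j, \sum_a x a * g a (tnth B j) = 0) ->
    forall a, x a = 0) ->
  jets_rank_ge K D s r -> jets_rank_ge K (B ++ D) s.+1 (b + r).
Proof.
move=> uBD lek gjet ltBD inj.
apply: (@jets_rank_ge_peel _ _ _ _ _ _ N k g (fun=> 0%N)
  (fun j => weight N k (tnth B j))) => // [a j m mD _|x xB]; first exact: ltBD.
by apply: inj => j; rewrite -[RHS](xB j); apply: eq_bigr => a _; rewrite eqxx.
Qed.

Lemma max_rank_peel_first (B : 4.-tuple (nat * nat)) D N k :
  uniq (B ++ D) -> (forall m : nat * nat, m \in B ++ D -> (m.1 + m.2 <= k)%N) ->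
  (forall j m, m \in D -> (weight N k (tnth B j) < weight N k m)%N) ->
  (forall x : 'I_4 -> K, (forall j, \sum_(c < 4) x c * jet K c (tnth B j) = 0) ->
    forall c, x c = 0) ->
  max_rank D -> max_rank (B ++ D).
Proof.
move=> uBD lek ltBD inj; apply: max_rank_peel4 => s r.
apply: (@jets_rank_ge_peel_first _ _ _ _ _ N k (fun c => jet K c)) => // a.
exists (fun c : nat => (c == a :> nat)%:R) => m.
rewrite (bigD1 a) //= eqxx mul1r big1 ?addr0 // => c ca.
by rewrite -[(c == a :> nat)]/(c == a) (negPf ca) mul0r.
Qed.

(** The points form a parallelogram, b1 - b0 = b3 - b2 = (1, -1). The alternating sum over its
    vertices kills affine functions and sends ij to -(2n + 1), an odd number. An affine function
    vanishing on the vertices is then zero, since they lie on two different layers. *)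
Lemma max_rank_peel22 k n D :
  (n < k)%N -> uniq D -> (forall m : nat * nat, m \in D -> (m.1 + m.2 < k)%N) ->
  max_rank (seg k n ++ D) -> max_rank (seg k.+1 2 ++ seg k n.+2 ++ D).
Proof.
move=> nk uD Dk.
pose b0 := (k, 1)%N; pose b1 := (k.+1, 0)%N.
pose b2 := (k - n.+1, n.+1)%N; pose b3 := (k - n, n)%N.
have eqD : [tuple b0; b1; b2; b3] ++ seg k n ++ D = seg k.+1 2 ++ seg k n.+2 ++ D.
  by rewrite !segS //; try lia; rewrite subn1 subn0.
rewrite -eqD; apply: (@max_rank_peel_first _ _ k.+2 k.+1).
- by rewrite eqD segs_uniq //; lia.
- move=> m; rewrite eqD !mem_cat !mem_seg; try lia.
  by case/or3P => [|| /Dk]; lia.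
- have wb0 : weight k.+2 k.+1 b0 = k by rewrite (@weight_eq _ _ 0) /=; lia.
  have wb1 : weight k.+2 k.+1 b1 = k.+1 by rewrite (@weight_eq _ _ 0) /=; lia.
  have wb2 : weight k.+2 k.+1 b2 = (k.+2 + (k - n.+1))%N.
    by rewrite (@weight_eq _ _ 1) /=; lia.
  have wb3 : weight k.+2 k.+1 b3 = (k.+2 + (k - n))%N.
    by rewrite (@weight_eq _ _ 1) /=; lia.
  move=> j m mD; have wj : (weight k.+2 k.+1 (tnth [tuple b0; b1; b2; b3] j) <= k.+2 + (k - n))%N.
    by case: j => -[|[|[|[|//]]]] ?; rewrite (tnth_nth (0, 0)%N) /= ?wb0 ?wb1 ?wb2 ?wb3; lia.
  apply: leq_ltn_trans wj _; move: mD; rewrite mem_cat mem_seg; last by lia.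
  case/orP => [/andP[am /eqP mk]|/Dk mk].
    by rewrite (@weight_eq _ _ 1) ?mk; lia.
  by apply: leq_trans (@weight_ge _ _ 2 _ _); lia.
move=> x xg.
have x0 := xg (@Ordinal 4 0 isT); have x1 := xg (@Ordinal 4 1 isT).
have x2 := xg (@Ordinal 4 2 isT); have x3 := xg (@Ordinal 4 3 isT).
move: x0 x1 x2 x3; rewrite !sum_ord4 /jet !(tnth_nth (0, 0)%N) /=.
pose u : K := k%:R; pose v : K := n%:R.
have -> : (k - n.+1)%:R = u - v - 1 :> K by rewrite natrB // -[n.+1%:R]natr1 opprD addrA.
have -> : (k - n)%:R = u - v :> K by rewrite natrB // ltnW.
rewrite -[n.+1%:R]natr1 -[k.+1%:R]natr1 -/u -/v.
set x0 := x _; set x1 := x _; set x2 := x _; set x3 := x _ => e0 e1 e2 e3.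
have odd0 : 2 * v + 1 != 0 :> K by rewrite -natrM natr1 pnatr_eq0.
have x30 : x3 = 0.
  apply: (mulIf odd0); rewrite mul0r.
  transitivity (- ((x0 * 1 + x1 * (u + 1) + x2 * 0 + x3 * ((u + 1) * 0))
    - (x0 * 1 + x1 * u + x2 * 1 + x3 * (u * 1)) + (x0 * 1 + x1 * (u - v - 1)
    + x2 * (v + 1) + x3 * ((u - v - 1) * (v + 1)))
    - (x0 * 1 + x1 * (u - v) + x2 * v + x3 * ((u - v) * v)))); first by ring.
  by rewrite e0 e1 e2 e3; ring.
move: e0 e1 e3; rewrite x30 !mul0r !mulr0 !mulr1 !addr0 => e0 e1 e3.
have x20 : x2 = x1.
  transitivity (x1 + (x0 + x1 * u + x2) - (x0 + x1 * (u + 1))); first by ring.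
  by rewrite e0 e1; ring.
have x10 : x1 = 0.
  transitivity (x0 + x1 * (u + 1) - (x0 + x1 * (u - v) + x1 * v)); first by ring.
  by rewrite e1 -{2}x20 e3; ring.
apply: forall_ord4 => //; last by rewrite -/x2 x20.
by move: e1; rewrite x10 mul0r addr0.
Qed.

(** A combination of 1, i, j, ij that vanishes at three points of i + j = k is a multiple of i + j -
    k, which takes the value 1 at (k + 1, 0). *)
Lemma max_rank_peel13 k n D :
  (n.+1 < k)%N -> uniq D -> (forall m : nat * nat, m \in D -> (m.1 + m.2 < k)%N) ->
  max_rank (seg k n ++ D) -> max_rank (seg k.+1 1 ++ seg k n.+3 ++ D).
Proof.
move=> nk uD Dk.
pose b0 := (k.+1, 0)%N; pose b1 := (k - n.+2, n.+2)%N.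
pose b2 := (k - n.+1, n.+1)%N; pose b3 := (k - n, n)%N.
have eqD : [tuple b0; b1; b2; b3] ++ seg k n ++ D = seg k.+1 1 ++ seg k n.+3 ++ D.
  by rewrite !segS //; try lia; rewrite subn0.
rewrite -eqD; apply: (@max_rank_peel_first _ _ k.+2 k.+1).
- by rewrite eqD segs_uniq //; lia.
- move=> m; rewrite eqD !mem_cat !mem_seg; try lia.
  by case/or3P => [|| /Dk]; lia.
- have wb0 : weight k.+2 k.+1 b0 = k.+1 by rewrite (@weight_eq _ _ 0) /=; lia.
  have wb1 : weight k.+2 k.+1 b1 = (k.+2 + (k - n.+2))%N.
    by rewrite (@weight_eq _ _ 1) /=; lia.
  have wb2 : weight k.+2 k.+1 b2 = (k.+2 + (k - n.+1))%N.
    by rewrite (@weight_eq _ _ 1) /=; lia.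
  have wb3 : weight k.+2 k.+1 b3 = (k.+2 + (k - n))%N.
    by rewrite (@weight_eq _ _ 1) /=; lia.
  move=> j m mD; have wj : (weight k.+2 k.+1 (tnth [tuple b0; b1; b2; b3] j) <= k.+2 + (k - n))%N.
    by case: j => -[|[|[|[|//]]]] ?; rewrite (tnth_nth (0, 0)%N) /= ?wb0 ?wb1 ?wb2 ?wb3; lia.
  apply: leq_ltn_trans wj _; move: mD; rewrite mem_cat mem_seg; last by lia.
  case/orP => [/andP[am /eqP mk]|/Dk mk].
    by rewrite (@weight_eq _ _ 1) ?mk; lia.
  by apply: leq_trans (@weight_ge _ _ 2 _ _); lia.
move=> x xg.
have x0 := xg (@Ordinal 4 0 isT); have x1 := xg (@Ordinal 4 1 isT).
have x2 := xg (@Ordinal 4 2 isT); have x3 := xg (@Ordinal 4 3 isT).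
move: x0 x1 x2 x3; rewrite !sum_ord4 /jet !(tnth_nth (0, 0)%N) /=.
pose l : K := k%:R; pose u : K := (k - n.+2)%:R.
have -> : (k - n.+1)%:R = u + 1 :> K by rewrite natr1; congr _%:R; lia.
have -> : (k - n)%:R = u + 2 :> K by rewrite -natrD; congr _%:R; lia.
have -> : n.+2%:R = l - u :> K by rewrite -natrB ?leq_subr //; congr _%:R; lia.
have -> : n.+1%:R = l - (u + 1) :> K by rewrite natr1 -natrB; [congr _%:R|]; lia.
have -> : n%:R = l - (u + 2) :> K by rewrite -natrD -natrB; [congr _%:R|]; lia.
rewrite -[k.+1%:R]natr1 -/u -/l; set x0 := x _; set x1 := x _; set x2 := x _; set x3 := x _.
move=> e0 e1 e2 e3.
have [] := @quadratic_eq0 (x0 + x2 * l) (x1 - x2 + x3 * l) (- x3) u.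
- by rewrite -[RHS]e1; ring.
- by rewrite -[RHS]e2; ring.
- by rewrite -[RHS]e3; ring.
move=> f0 f1 /eqP; rewrite oppr_eq0 => /eqP x30.
have x21 : x1 = x2 by apply/eqP; rewrite -subr_eq0 -f1 x30 mul0r addr0.
move: e0; rewrite x21 x30 !mulr0 mulr1 ?mul0r !addr0 => e0.
have x20 : x2 = 0.
  transitivity (x0 + x2 * (l + 1) - (x0 + x2 * l)); first by ring.
  by rewrite e0 f0 subrr.
apply: forall_ord4 => //; last by rewrite -/x1 x21.
by move: f0; rewrite x20 mul0r addr0.
Qed.

(* On the layer i + j = k the monomials 1, i, ij are equivalent to 1, i, i^2. *)
Lemma jets_rank_ge_seg k a b s r : (b <= 3)%N -> (a + b <= k.+1)%N ->
  jets_rank_ge K (seg k a) s r -> jets_rank_ge K (seg k (b + a)) s.+1 (b + r).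
Proof.
move=> b3 abk.
pose B := [tuple (k.+1 - (b + a) + j, k - (k.+1 - (b + a) + j))%N | j < b].
have eqD : B ++ seg k a = seg k (b + a).
  rewrite /seg iotaD map_cat; congr (_ ++ map _ (iota _ _)); last by lia.
  have -> m : iota m b = [seq (m + j)%N | j : 'I_b].
    by rewrite -{1}[m]addn0 iotaDl -val_enum_ord -map_comp.
  by rewrite -map_comp.
(* On the layer, k i - ij equals i^2. With [N] = 0 the weight is just i. *)
rewrite -eqD; apply: (@jets_rank_ge_peel_first _ _ _ _ _ 0 k
  (fun c m => nth 0 [:: 1; m.1%:R; k%:R * m.1%:R - m.1%:R * m.2%:R] c)).
- by rewrite eqD seg_uniq.
- by move=> m; rewrite eqD mem_seg; lia.
- move=> c; exists (fun i => nth 0 (nth [::] [:: [:: 1; 0; 0; 0]; [:: 0; 1; 0; 0];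
     [:: 0; k%:R; 0; -1]] c) i) => m.
  rewrite !big_ord_recl big_ord0 /jet /=.
  by case: c => -[|[|[|c]]] ? /=; try ring; lia.
- move=> j m; rewrite tnth_mktuple mem_seg; last by lia.
  case/andP=> am /eqP mk; have jb := ltn_ord j.
  by rewrite !(@weight_eq _ _ 0) ?addn0 ?muln0 //= ?subnKC //; lia.
(* Vandermonde by counting roots: a polynomial in i of size at most [b] with [b] distinct roots is
   zero. *)
move=> x xB; pose p : {poly K} := \poly_(c < b) oapp x 0 (insub c).
have pE (c : 'I_b) : p`_c = x c by rewrite coef_poly ltn_ord valK.
pose i0 := (k.+1 - (b + a))%N.
pose roots := [seq (i0 + j)%:R : K | j <- iota 0 b].
suff p0 : p = 0 by move=> c; rewrite -pE p0 coef0.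
have uroots : uniq roots.
  by rewrite map_inj_uniq ?iota_uniq // => i j /eqP; rewrite eqr_nat eqn_add2l => /eqP.
suff allr : all (root p) roots.
  apply/eqP/negPn/negP => /max_poly_roots/(_ allr uroots).
  by rewrite size_map size_iota ltnNge size_poly.
apply/allP => _ /mapP[j + ->]; rewrite mem_iota add0n => /= jb.
rewrite rootE horner_poly -[X in _ == X](xB (Ordinal jb)); apply/eqP/eq_bigr => c _.
rewrite -pE coef_poly ltn_ord tnth_mktuple /= -/i0; congr (_ * _).
have i0j : (i0 + j <= k)%N by rewrite /i0; lia.
case: c => -[|[|[|c]]] /= cb; rewrite ?expr0 ?expr1 ?natrB //; try ring.
by lia.
Qed.

(* The number of points of the next layer used up together with [a] points of a
   layer: one for each triple, and two (three) with the last two points (point). *)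
Definition need a := (4 * ((a + 2) %/ 3) - a)%N.

Lemma max_rank_layer k a n D :
  (a <= k.+2)%N -> (n <= k.+1)%N -> (need a <= n)%N -> uniq D ->
  (forall m : nat * nat, m \in D -> (m.1 + m.2 < k)%N) ->
  max_rank (seg k (n - need a) ++ D) -> max_rank (seg k.+1 a ++ seg k n ++ D).
Proof.
move=> ak nk + uD Dk; rewrite /need.
elim/ltn_ind: a n ak nk => -[|[|[|a]]] IH n ak nk.
- by move=> _; rewrite -[(n - _)%N]/(n - 0)%N subn0.
- case: n nk => [|[|[|n]]] nk // _; rewrite -[(_ - _)%N]/(n - 0)%N subn0.
  by apply: max_rank_peel13 => //; lia.
- case: n nk => [|[|n]] nk // _; rewrite -[(_ - _)%N]/(n - 0)%N subn0.
  by apply: max_rank_peel22 => //; lia.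
case: n nk => [|n] nk an; first by lia.
case: k ak nk Dk IH => [|k] ak nk Dk IH; first by lia.
have -> : (n.+1 - (4 * ((a.+3 + 2) %/ 3) - a.+3) = n - (4 * ((a + 2) %/ 3) - a))%N by lia.
move=> mD; apply: max_rank_peel31 => //; try lia.
by apply: IH => //; lia.
Qed.

Fixpoint layers n := if n is n'.+1 then seg n' n ++ layers n' else [::].

Lemma layersS n : layers n.+1 = seg n n.+1 ++ layers n. Proof. by []. Qed.

(** The points with 3 <= i + j <= n + 2, that is, the monomials of degree n + 2 in the ideal of the
    triple point at [0 : 0 : 1]. *)
Fixpoint upper_layers n := if n is n'.+1 then seg (n' + 3) (n' + 4) ++ upper_layers n' else [::].

Lemma layers_upper n : layers (n + 3) = upper_layers n ++ layers 3.
Proof.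
elim: n => [|n IH] //.
by rewrite addSn layersS IH catA -addnS.
Qed.

Lemma mem_layers n (m : nat * nat) : (m \in layers n) = (m.1 + m.2 < n)%N.
Proof.
elim: n => [|n IH]; first by rewrite ltn0.
by rewrite layersS mem_cat IH mem_seg // subnn [RHS]ltnS [RHS]leq_eqVlt.
Qed.

Lemma layers_uniq n : uniq (layers n).
Proof.
elim: n => // n IH; rewrite layersS cat_uniq seg_uniq IH andbT /=.
by apply/hasPn => m; rewrite mem_layers mem_seg //; lia.
Qed.

Lemma size_layers n : size (layers n) = 'C(n.+1, 2).
Proof. by elim: n => // n IH; rewrite layersS size_cat size_seg IH [RHS]binS bin1 addnC. Qed.

Lemma upper_layers_uniq n : uniq (upper_layers n).
Proof. by have := layers_uniq (n + 3); rewrite layers_upper cat_uniq => /andP[]. Qed.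

Lemma mem_upper_layers n (m : nat * nat) : m \in upper_layers n -> (3 <= m.1 + m.2 < n + 3)%N.
Proof.
move=> mn; rewrite -mem_layers layers_upper mem_cat mn andbT leqNgt -mem_layers.
have := layers_uniq (n + 3); rewrite layers_upper cat_uniq => /and3P[_ /hasPn + _].
by move=> nm; apply/negP => /nm; rewrite mn.
Qed.

Lemma size_upper_layers n : (size (upper_layers n) + 6 = 'C(n.+4, 2))%N.
Proof. by have := size_layers (n + 3); rewrite layers_upper size_cat addn3. Qed.

Lemma jets_rank_ge_seg3 a s : (0 < s)%N -> (a <= 3)%N ->
  jets_rank_ge K (seg 3 a) s a.
Proof.
case: s => // s _ a3; have := @jets_rank_ge_seg 3 0 a s 0 a3; rewrite !addn0.
by apply; [exact: leq_trans a3 _ | exact: jets_rank_ge0].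
Qed.

Lemma max_rank_seg3 a : (a <= 3)%N -> max_rank (seg 3 a).
Proof.
move=> a3 [|s]; first by rewrite min0n; apply: jets_rank_ge0.
have am : (a <= 4 * s.+1)%N by lia.
by rewrite size_seg (minn_idPr am); apply: jets_rank_ge_seg3.
Qed.

(* On layer 3 alone four points remain dependent under one 2-square, so the layer
   above it must not be exhausted exactly. *)
Lemma max_rank_upper n a : (a <= n + 4)%N -> (n = 0 -> a <= 3)%N -> (n = 1 -> 0 < a)%N ->
  max_rank (seg (n + 3) a ++ upper_layers n).
Proof.
elim: n a => [|n IH] a an a0 a1.
  by rewrite cats0; apply: max_rank_seg3; apply: a0.
rewrite addSn /=; apply: max_rank_layer; rewrite ?upper_layers_uniq //; try (rewrite /need; lia).
  by move=> m /mem_upper_layers; lia.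
(* For n = 0 the nonempty upper segment uses at least one of the four points of layer 3. For n = 1
   it has at most six points and uses at most four of the five points of layer 4, so the segment
   passed on is nonempty. *)
by apply: IH; rewrite /need; lia.
Qed.

Lemma max_rank_upper_layers n : (1 < n)%N -> max_rank (upper_layers n).
Proof. by case: n => [|n] // n1; apply: max_rank_upper; lia. Qed.

(** Layer 3 needs two 2-squares: one takes three of its points, another the fourth. *)
Lemma jets_rank_ge_cubics s : jets_rank_ge K (upper_layers 1) s.+2 4.
Proof.
rewrite -[upper_layers 1]/(seg 3 4 ++ [::]) cats0.
by apply: (@jets_rank_ge_seg 3 1 3) => //; apply: jets_rank_ge_seg3.
Qed.

End Peels.

(** * Ideal membership in coordinates *)

Local Notation i0 := (@Ordinal 3 0 isT).
Local Notation i1 := (@Ordinal 3 1 isT).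
Local Notation i2 := (@Ordinal 3 2 isT).

Lemma big_ord3 (T : Type) (idx : T) (op : Monoid.law idx) (F : 'I_3 -> T) :
  \big[op/idx]_(i < 3) F i = op (op (F i0) (F i1)) (F i2).
Proof.
rewrite !big_ord_recl big_ord0 Monoid.mulm1 Monoid.mulmA.
by congr (op (op (F _) (F _)) (F _)); apply/val_inj.
Qed.

Lemma forall_ord3 (P : 'I_3 -> Prop) : P i0 -> P i1 -> P i2 -> forall i, P i.
Proof.
move=> P0 P1 P2 [[|[|[|//]]] lti].
- by move: P0; congr P; apply/val_inj.
- by move: P1; congr P; apply/val_inj.
- by move: P2; congr P; apply/val_inj.
Qed.

Definition mon (i j l : nat) : 'X_{1..3} := [multinom nth 0%N [:: i; j; l] k | k < 3].

Lemma mon0 i j l : mon i j l i0 = i. Proof. by rewrite mnmE. Qed.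
Lemma mon1 i j l : mon i j l i1 = j. Proof. by rewrite mnmE. Qed.
Lemma mon2 i j l : mon i j l i2 = l. Proof. by rewrite mnmE. Qed.

Lemma mdeg3 (m : 'X_{1..3}) : mdeg m = (m i0 + m i1 + m i2)%N.
Proof. by rewrite mdegE big_ord3. Qed.

Lemma mnm3P (m m' : 'X_{1..3}) :
  m i0 = m' i0 -> m i1 = m' i1 -> m i2 = m' i2 -> m = m'.
Proof. by move=> e0 e1 e2; apply/mnmP; apply: forall_ord3. Qed.

Lemma monE (m : 'X_{1..3}) : m = mon (m i0) (m i1) (mdeg m - m i0 - m i1).
Proof. by apply: mnm3P; rewrite mnmE //= mdeg3; lia. Qed.

Section Frames.
Variable R : realType.
Local Notation C := (CC R).
Local Notation S := {mpoly C[3]}.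
Implicit Types (a b q : 'I_3 -> C) (F G : S).

Lemma linformE a : linform a = a i0 *: 'X_i0 + a i1 *: 'X_i1 + a i2 *: 'X_i2.
Proof. by rewrite /linform big_ord3. Qed.

(* The coordinates of the point where the lines [a] and [b] meet. *)
Definition meet_x a b := a i1 * b i2 - a i2 * b i1.
Definition meet_y a b := a i2 * b i0 - a i0 * b i2.
Definition meet_z a b := a i0 * b i1 - a i1 * b i0.

(* [psi a b] is, up to the factor [meet_z a b], the inverse of the substitution
   of [linform a], [linform b] and Z for the variables. *)
Definition psi_subst a b : 3.-tuple S :=
  [tuple b i1 *: 'X_i0 - a i1 *: 'X_i1 + meet_x a b *: 'X_i2;
         a i0 *: 'X_i1 - b i0 *: 'X_i0 + meet_y a b *: 'X_i2; meet_z a b *: 'X_i2].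
Definition psi a b F : S := F \mPo psi_subst a b.

Definition chi_subst a b : 3.-tuple S := [tuple linform a; linform b; 'X_i2].

Lemma psi_linform a b c : psi a b (linform c) =
  c i0 *: tnth (psi_subst a b) i0 + c i1 *: tnth (psi_subst a b) i1
  + c i2 *: tnth (psi_subst a b) i2.
Proof.
by rewrite /psi linformE !comp_mpolyD !comp_mpolyZ !comp_mpolyXU !(tnth_nth 0).
Qed.

Lemma psi_linform_l a b : psi a b (linform a) = meet_z a b *: 'X_i0.
Proof.
rewrite psi_linform !(tnth_nth 0) /= /meet_x /meet_y /meet_z.
rewrite -!mul_mpolyC !(rmorphB, rmorphM) /=; ring.
Qed.

Lemma psi_linform_r a b : psi a b (linform b) = meet_z a b *: 'X_i1.
Proof.
rewrite psi_linform !(tnth_nth 0) /= /meet_x /meet_y /meet_z.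
rewrite -!mul_mpolyC !(rmorphB, rmorphM) /=; ring.
Qed.

Lemma chi_psi_subst a b i : tnth (psi_subst a b) i \mPo chi_subst a b = meet_z a b *: 'X_i.
Proof.
apply: (forall_ord3 (P := fun i => tnth (psi_subst a b) i \mPo chi_subst a b = meet_z a b *: 'X_i));
  rewrite !(tnth_nth 0) /= !(comp_mpolyD, comp_mpolyN, comp_mpolyZ) !comp_mpolyXU /= ?linformE //;
  rewrite /meet_x /meet_y /meet_z -!mul_mpolyC !(rmorphB, rmorphM) /=; ring.
Qed.

Lemma psi_subst_dhomog a b i : tnth (psi_subst a b) i \is 1.-homog.
Proof.
apply: (forall_ord3 (P := fun i => is_true (tnth (psi_subst a b) i \is 1.-homog)));
  by rewrite !(tnth_nth 0) /= ?rpredD ?rpredN ?rpredZ // dhomogX /= mdeg1.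
Qed.

Lemma psi_dhomog a b F d : F \is d.-homog -> psi a b F \is d.-homog.
Proof.
move=> /dhomogP Fd; rewrite /psi comp_mpolyE big_seq rpred_sum // => m /Fd md.
have -> : d = (1 * m i0 + 1 * m i1 + 1 * m i2)%N by rewrite -md /= mdeg3 !mul1n.
by rewrite rpredZ // big_ord3 !dhomogM // dhomogMn // psi_subst_dhomog.
Qed.

(** Keeping the factor instead of dividing by it leaves [psi] polynomial in the coefficients of the
    two lines, as the genericity argument requires. *)
Lemma chi_psi a b F d : F \is d.-homog ->
  psi a b F \mPo chi_subst a b = meet_z a b ^+ d *: F.
Proof.
move=> /dhomogP Fd; rewrite /psi (comp_mpolyEX F) raddf_sum /= [X in _ *: X]mpolyE scaler_sumr.
apply: eq_big_seq => m /Fd md.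
rewrite !comp_mpolyZ scalerA mulrC -scalerA; congr (_ *: _).
rewrite comp_mpolyX rmorph_prod /= big_ord3 !rmorphXn /= !chi_psi_subst.
rewrite [in RHS]mpolyXE_id big_ord3 /= -md /= mdeg3 !exprD !exprZn.
by rewrite -!mul_mpolyC !rmorphM /=; ring.
Qed.

Definition frame_monomial a b (m : 'X_{1..3}) : S :=
  linform a ^+ m i0 * linform b ^+ m i1 * 'X_i2 ^+ m i2.

Lemma frame_expansion a b F d : F \is d.-homog -> meet_z a b != 0 ->
  F = \sum_(m <- msupp (psi a b F))
    (meet_z a b ^- d * (psi a b F)@_m) *: frame_monomial a b m.
Proof.
move=> Fd z0; apply: (scalerI (expf_neq0 d z0)); rewrite -chi_psi //.
rewrite comp_mpolyE scaler_sumr; apply: eq_bigr => m _.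
by rewrite scalerA mulVKf ?expf_neq0 // big_ord3 !(tnth_nth 0).
Qed.

(** Membership in the power (X, Y)^k of the ideal of [0 : 0 : 1]. *)
Definition ord_ge k F := forall m : 'X_{1..3}, (m i0 + m i1 < k)%N -> F@_m = 0.

Lemma ord_geM j k F G : ord_ge j F -> ord_ge k G -> ord_ge (j + k) (F * G).
Proof.
move=> Fj Gk m mjk; rewrite mcoeffM big1 // => -[m1 m2] /= /eqP mE.
have mi i : m i = (bmnm m1 i + bmnm m2 i)%N by rewrite -mnmDE -mE.
rewrite !mi in mjk.
have [lt1|ge1] := ltnP (m1 i0 + m1 i1) j; first by rewrite Fj ?mul0r.
by rewrite (Gk m2) ?mulr0 //; lia.
Qed.

Lemma in_I_2square_sum a b (I : eqType) (r : seq I) (F : I -> S) :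
  (forall i, i \in r -> in_I_2square (linform a) (linform b) (F i)) ->
  in_I_2square (linform a) (linform b) (\sum_(i <- r) F i).
Proof.
move=> Fr; rewrite big_seq; elim/big_ind: _ => [|x y|i /Fr] //.
  by exists 0, 0; rewrite !mul0r addr0.
case=> G1 [G2 ->] [H1 [H2 ->]]; exists (G1 + H1), (G2 + H2); ring.
Qed.

Lemma in_I_triple_sum q (I : eqType) (r : seq I) (F : I -> S) :
  (forall i, i \in r -> in_I_triple q (F i)) -> in_I_triple q (\sum_(i <- r) F i).
Proof.
move=> Fr; rewrite big_seq; elim/big_ind: _ => [|x y|i /Fr] //.
  by exists 0%N, (fun=> 0), (fun=> 0), (fun=> 0); split=> [[]|] //; rewrite big_ord0.
case=> k [A [B [D [ABD ->]]]] [k' [A' [B' [D' [ABD' ->]]]]].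
pose cat (f : 'I_k -> S) (f' : 'I_k' -> S) j :=
  match split j with inl i => f i | inr i => f' i end.
exists (k + k')%N, (cat A A'), (cat B B'), (cat D D'); split=> [j|].
  by rewrite /cat; case: split.
rewrite big_split_ord; congr (_ + _); apply: eq_bigr => j _;
  by rewrite /cat ?(unsplitK (inl _)) ?(unsplitK (inr _)).
Qed.

Lemma psiD a b F G : psi a b (F + G) = psi a b F + psi a b G.
Proof. exact: comp_mpolyD. Qed.

Lemma psiM a b F G : psi a b (F * G) = psi a b F * psi a b G.
Proof. exact: rmorphM. Qed.

(** In the frame of the two lines and Z the ideal becomes the monomial ideal (X^2, Y^2), so
    membership is read off the coefficients. *)
Lemma in_I_2squareP a b F d : F \is d.-homog -> meet_z a b != 0 ->
  in_I_2square (linform a) (linform b) F <->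
  (forall m : 'X_{1..3}, (m i0 <= 1)%N -> (m i1 <= 1)%N -> mdeg m = d -> (psi a b F)@_m = 0).
Proof.
move=> Fd z0; split=> [[G1 [G2 ->]] m m0 m1 _|F0].
  have psi2 (L X G : S) e : psi a b L = e *: X ->
      psi a b (G * L ^+ 2) = e ^+ 2 *: (psi a b G * X ^+ 2).
    by move=> LE; rewrite expr2 !psiM LE -!mul_mpolyC rmorphXn /=; ring.
  rewrite psiD (psi2 _ _ _ _ (psi_linform_l a b)) (psi2 _ _ _ _ (psi_linform_r a b)).
  rewrite mcoeffD !mcoeffZ.
  have mX (i : 'I_3) G : (m i <= 1)%N -> (G * 'X_i ^+ 2)@_m = 0.
    move=> mi; rewrite mpolyXn mcoeffM big1 // => -[n1 n2] /= /eqP mE.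
    rewrite mcoeffX; case: eqP => [e|]; rewrite ?mulr0 //.
    have m2 : m i = (bmnm n1 i + bmnm n2 i)%N by rewrite -mnmDE -mE.
    by move: mi; rewrite m2 -e mulmnE mnm1E eqxx; lia.
  by rewrite !mX // !mulr0 addr0.
rewrite (frame_expansion Fd z0); apply: in_I_2square_sum => m mF.
have md : mdeg m = d by have /dhomogP/(_ _ mF) := psi_dhomog a b Fd.
set c := _ * _; rewrite /frame_monomial.
have [m0|] := leqP (m i0) 1; last first.
  move=> /subnKC <-; exists (c *: (linform a ^+ (m i0 - 2) * linform b ^+ m i1 * 'X_i2 ^+ m i2)), 0.
  by rewrite mul0r addr0 exprD -!mul_mpolyC; ring.
have [m1|] := leqP (m i1) 1.
  by move: mF; rewrite mcoeff_msupp F0 // eqxx.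
move=> /subnKC <-; exists 0, (c *: (linform a ^+ m i0 * linform b ^+ (m i1 - 2) * 'X_i2 ^+ m i2)).
by rewrite mul0r add0r exprD -!mul_mpolyC; ring.
Qed.

Lemma in_I_point_linform q a :
  \sum_(i < 3) a i * q i = 0 -> in_I_point q (linform a).
Proof.
move=> aq t; rewrite /linform raddf_sum /= -[RHS](mulr0 t) -[in RHS]aq mulr_sumr.
by apply: eq_bigr => i _; rewrite mevalZ mevalXU mulrCA.
Qed.

Lemma in_I_pointM q F G : in_I_point q F -> in_I_point q (F * G).
Proof. by move=> Fq t; rewrite mevalM Fq mul0r. Qed.

Lemma in_I_tripleM q A B D G : in_I_point q A -> in_I_point q B -> in_I_point q D ->
  in_I_triple q (A * B * D * G).
Proof.
move=> Aq Bq Dq; exists 1%N, (fun=> A), (fun=> B), (fun=> D * G); split.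
  by move=> _; do !split => //; apply: in_I_pointM.
by rewrite big_ord1 mulrA.
Qed.

(** At (0, 0, t) the value of [psi a b F] is that of [F] at t c q. The terms free of X and Y
    therefore form a polynomial in t that vanishes everywhere. *)
Lemma psi_ord_ge1 a b q (c : C) F :
  [/\ meet_x a b = c * q i0, meet_y a b = c * q i1 & meet_z a b = c * q i2] ->
  in_I_point q F -> ord_ge 1 (psi a b F).
Proof.
case=> qx qy qz Fq m m01.
pose r : {poly C} := \sum_(n <- msupp (psi a b F))
   ((psi a b F)@_n * ((n i0 == 0) && (n i1 == 0))%N%:R) *: 'X^(n i2).
have r0 t : r.[t] = 0.
  have := Fq (t * c); rewrite -[X in _ -> X = _]/(r.[t]).
  have -> : F.@[fun i => t * c * q i] = (psi a b F).@[fun i : 'I_3 => if i == i2 then t else 0].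
    rewrite comp_mpoly_meval; apply: meval_eq; apply: forall_ord3; rewrite (tnth_nth 0) /=;
      rewrite !(mevalD, mevalN, mevalZ, mevalXU) /= ?qx ?qy ?qz; ring.
  move=> <-; rewrite mevalE horner_sum; apply: eq_bigr => n _.
  by rewrite big_ord3 /= !expr0n hornerZ hornerXn -mulnb natrM !mulrA.
have r_eq0 : r = 0 by apply/eqP; apply/contraT => /poly_neq0_eval[t _]; rewrite r0 eqxx.
have [|/negPf mF] := boolP (m \in msupp (psi a b F)); last first.
  by apply/eqP; rewrite mcoeff_eq0 mF.
move=> mF; have := congr1 (fun p : {poly C} => p`_(m i2)) r_eq0.
have [m0 m1] : m i0 = 0%N /\ m i1 = 0%N by lia.
rewrite coef0 /r coef_sum (bigD1_seq m) ?msupp_uniq //= m0 m1 !eqxx mulr1.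
rewrite coefZ coefXn eqxx mulr1 big1 ?addr0 // => n nm.
rewrite coefZ coefXn; case: (n i0 =P 0%N) => n0; last by rewrite mulr0 mul0r.
case: (n i1 =P 0%N) => n1; last by rewrite mulr0 mul0r.
case: eqP => e; last by rewrite mulr0.
by case/eqP: nm; apply: mnm3P; rewrite ?n0 ?n1 ?m0 ?m1.
Qed.

(** The two lines meet at q, so in their frame the ideal of q becomes (X, Y) and orders of vanishing
    add up to 3. Conversely, a monomial of order at least 3 in the two lines splits off three
    factors vanishing at q. *)
Lemma in_I_tripleP a b q (c : C) F d : F \is d.-homog -> meet_z a b != 0 ->
  [/\ meet_x a b = c * q i0, meet_y a b = c * q i1 & meet_z a b = c * q i2] ->
  \sum_(i < 3) a i * q i = 0 -> \sum_(i < 3) b i * q i = 0 ->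
  in_I_triple q F <->
  (forall m : 'X_{1..3}, (m i0 + m i1 <= 2)%N -> mdeg m = d -> (psi a b F)@_m = 0).
Proof.
move=> Fd z0 qP aq bq; split=> [[k [A [B [D [ABD ->]]]]] m m2 _|F0].
  rewrite /psi (raddf_sum (comp_mpoly _)) (raddf_sum (mcoeff m)) /= big1 // => j _.
  rewrite -/(psi a b _) !psiM; have [Aq [Bq Dq]] := ABD j.
  by apply: (ord_geM (ord_geM (psi_ord_ge1 qP Aq) (psi_ord_ge1 qP Bq)) (psi_ord_ge1 qP Dq)).
rewrite (frame_expansion Fd z0); apply: in_I_triple_sum => m mF.
have md : mdeg m = d by have /dhomogP/(_ _ mF) := psi_dhomog a b Fd.
set e := _ * _; rewrite /frame_monomial.
have [m2|m3] := leqP (m i0 + m i1) 2; first by move: mF; rewrite mcoeff_msupp F0 // eqxx.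
have la := in_I_point_linform aq; have lb := in_I_point_linform bq.
set La := linform a in la *; set Lb := linform b in lb *.
rewrite -mul_mpolyC; set X := 'X_i2 ^+ _.
case: (m i0) m3 => [|[|[|k]]] m3.
- have [k ->] : exists k, m i1 = k.+3 by exists (m i1 - 3)%N; lia.
  rewrite (_ : e%:MP * _ = Lb * Lb * Lb * (e%:MP * Lb ^+ k * X)); last first.
    by rewrite !exprS expr0; ring.
  exact: in_I_tripleM.
- have [k ->] : exists k, m i1 = k.+2 by exists (m i1 - 2)%N; lia.
  rewrite (_ : e%:MP * _ = La * Lb * Lb * (e%:MP * Lb ^+ k * X)); last first.
    by rewrite !exprS expr0; ring.
  exact: in_I_tripleM.
- have [k ->] : exists k, m i1 = k.+1 by exists (m i1 - 1)%N; lia.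
  rewrite (_ : e%:MP * _ = La * La * Lb * (e%:MP * Lb ^+ k * X)); last first.
    by rewrite !exprS expr0; ring.
  exact: in_I_tripleM.
rewrite (_ : e%:MP * _ = La * La * La * (e%:MP * La ^+ k * Lb ^+ m i1 * X)); last first.
    by rewrite !exprS; ring.
exact: in_I_tripleM.
Qed.

End Frames.

(** * Polynomial dependence on the parameters *)

Section PolynomialFamilies.
Variables (R : realType) (n : nat).
Local Notation C := (CC R).
Local Notation S := {mpoly C[3]}.
Local Notation param := ('I_n -> C).

Definition polyfun (f : param -> C) :=
  exists H : {mpoly C[n]}, forall v, H.@[v] = f v.

Definition polyfam (F : param -> S) := forall m, polyfun (fun v => (F v)@_m).

Lemma polyfun_const c : polyfun (fun=> c).
Proof. by exists c%:MP => v; rewrite mevalC. Qed.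

Lemma polyfun_vget k : polyfun (fun v => vget v k).
Proof.
rewrite /vget; case: insubP => [i _ _|_]; last exact: polyfun_const.
by exists 'X_i => v; rewrite mevalXU.
Qed.

Lemma polyfunD f g : polyfun f -> polyfun g -> polyfun (fun v => f v + g v).
Proof. by move=> [F fE] [G gE]; exists (F + G) => v; rewrite mevalD fE gE. Qed.

Lemma polyfunM f g : polyfun f -> polyfun g -> polyfun (fun v => f v * g v).
Proof. by move=> [F fE] [G gE]; exists (F * G) => v; rewrite mevalM fE gE. Qed.

Lemma polyfunN f : polyfun f -> polyfun (fun v => - f v).
Proof. by move=> [F fE]; exists (- F) => v; rewrite mevalN fE. Qed.

Lemma polyfunB f g : polyfun f -> polyfun g -> polyfun (fun v => f v - g v).
Proof. by move=> pf pg; apply/polyfunD/polyfunN. Qed.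

Lemma polyfun_sum (I : Type) (r : seq I) (P : pred I) (f : I -> param -> C) :
  (forall i, polyfun (f i)) -> polyfun (fun v => \sum_(i <- r | P i) f i v).
Proof.
move=> pf; elim: r => [|i r [H HE]].
  by exists 0 => v; rewrite big_nil meval0.
have [F fE] := pf i; exists ((if P i then F else 0) + H) => v.
by rewrite big_cons mevalD HE; case: ifP; rewrite ?fE ?meval0 ?add0r.
Qed.

Lemma polyfun_prod (I : Type) (r : seq I) (f : I -> param -> C) :
  (forall i, polyfun (f i)) -> polyfun (fun v => \prod_(i <- r) f i v).
Proof.
move=> pf; elim: r => [|i r [H HE]].
  by exists 1 => v; rewrite big_nil meval1.
by have [F fE] := pf i; exists (F * H) => v; rewrite big_cons mevalM HE fE.
Qed.

Lemma polyfun_det k (M : param -> 'M[C]_k) :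
  (forall i j, polyfun (fun v => M v i j)) -> polyfun (fun v => \det (M v)).
Proof.
move=> pM; apply: polyfun_sum => s; apply: polyfunM; first exact: polyfun_const.
exact: polyfun_prod.
Qed.

Lemma polyfun_mulmx k l m (M : param -> 'M[C]_(k, l)) (N : param -> 'M[C]_(l, m)) :
  (forall i j, polyfun (fun v => M v i j)) -> (forall i j, polyfun (fun v => N v i j)) ->
  forall i j, polyfun (fun v => (M v *m N v) i j).
Proof.
move=> pM pN i j.
have [H HE] : polyfun (fun v => \sum_k M v i k * N v k j).
  by apply: polyfun_sum => c; apply: polyfunM.
by exists H => v; rewrite mxE.
Qed.

Lemma polyfam_const F : polyfam (fun=> F).
Proof. by move=> m; apply: polyfun_const. Qed.

Lemma polyfamD F G : polyfam F -> polyfam G -> polyfam (fun v => F v + G v).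
Proof.
move=> pF pG m; have [H HE] := polyfunD (pF m) (pG m).
by exists H => v; rewrite mcoeffD.
Qed.

Lemma polyfamZ f F : polyfun f -> polyfam F -> polyfam (fun v => f v *: F v).
Proof.
move=> pf pF m; have [H HE] := polyfunM pf (pF m).
by exists H => v; rewrite mcoeffZ.
Qed.

Lemma polyfamB F G : polyfam F -> polyfam G -> polyfam (fun v => F v - G v).
Proof.
move=> pF pG m; have [H HE] := polyfunB (pF m) (pG m).
by exists H => v; rewrite mcoeffB.
Qed.

Lemma polyfamM F G : polyfam F -> polyfam G -> polyfam (fun v => F v * G v).
Proof.
move=> pF pG m.
have [H HE] : polyfun (fun v => \sum_(k : 'X_{1..3 < (mdeg m).+1, (mdeg m).+1}
    | (m == (k.1 + k.2)%MM)) (F v)@_k.1 * (G v)@_k.2).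
  by apply: polyfun_sum => k; apply: polyfunM.
by exists H => v; rewrite mcoeffM.
Qed.

Lemma polyfamX F k : polyfam F -> polyfam (fun v => F v ^+ k).
Proof.
move=> pF; elim: k => [|k IH]; first exact: polyfam_const.
move=> m; have [H HE] := polyfamM pF IH m.
by exists H => v; rewrite exprS.
Qed.

Lemma polyfam_psi (a b : param -> 'I_3 -> C) m :
  (forall i, polyfun (fun v => a v i)) -> (forall i, polyfun (fun v => b v i)) ->
  polyfam (fun v => psi (a v) (b v) 'X_[m]).
Proof.
move=> pa pb k.
have pX i : polyfam (fun=> 'X_i) by apply: polyfam_const.
have px : polyfun (fun v => meet_x (a v) (b v)) by apply: polyfunB; apply: polyfunM.
have py : polyfun (fun v => meet_y (a v) (b v)) by apply: polyfunB; apply: polyfunM.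
have pz : polyfun (fun v => meet_z (a v) (b v)) by apply: polyfunB; apply: polyfunM.
have /(_ k)[H HE] : polyfam (fun v => (b v i1 *: 'X_i0 - a v i1 *: 'X_i1
     + meet_x (a v) (b v) *: 'X_i2) ^+ m i0 *
  (a v i0 *: 'X_i1 - b v i0 *: 'X_i0 + meet_y (a v) (b v) *: 'X_i2) ^+ m i1 *
  (meet_z (a v) (b v) *: 'X_i2) ^+ m i2 : S).
  apply: polyfamM; [apply: polyfamM|]; apply: polyfamX; last exact: polyfamZ.
    by apply: polyfamD; [apply: polyfamB|]; apply: polyfamZ.
  by apply: polyfamD; [apply: polyfamB|]; apply: polyfamZ.
by exists H => v; rewrite HE /psi comp_mpolyX big_ord3 !(tnth_nth 0).
Qed.

Lemma general_and (P Q : param -> Prop) :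
  general_prop P -> general_prop Q -> general_prop (fun v => P v /\ Q v).
Proof.
move=> [H [H0 HP]] [G [G0 GQ]]; exists (H * G); split; first by rewrite mulf_neq0.
by move=> v; rewrite mevalM mulf_eq0 negb_or => /andP[/HP ? /GQ ?].
Qed.

Lemma general_imp (P Q : param -> Prop) :
  (forall v, P v -> Q v) -> general_prop P -> general_prop Q.
Proof. by move=> PQ [H [H0 HP]]; exists H; split=> // v /HP/PQ. Qed.

Lemma general_forall s (P : nat -> param -> Prop) :
  (forall i, (i < s)%N -> general_prop (P i)) ->
  general_prop (fun v => forall i, (i < s)%N -> P i v).
Proof.
elim: s => [|s IH] Ps.
  by exists 1; split; rewrite ?oner_neq0 // => v _ i; rewrite ltn0.
have /general_imp := general_and (IH (fun i lt => Ps i (ltnW lt))) (Ps s (leqnn _)).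
apply=> v [Pv Psv] i; rewrite ltnS leq_eqVlt => /predU1P[-> //|]; exact: Pv.
Qed.

Lemma general_neq0 f v0 : polyfun f -> f v0 != 0 -> general_prop (fun v => f v != 0).
Proof.
move=> [H HE] f0; exists H; split; last by move=> v; rewrite HE.
by apply: contraNneq f0 => H0; rewrite -HE H0 meval0.
Qed.

End PolynomialFamilies.

(** * Coefficient vectors and the matrix of conditions *)

Section Coordinates.
Variables (R : realType) (d : nat).
Local Notation C := (CC R).
Local Notation S := {mpoly C[3]}.
Definition nmon := size (layers d.+1).

(* The exponents of the monomials X^i Y^j Z^(d - i - j) are encoded by the pairs (i, j). *)
Definition dmon (m : nat * nat) := mon m.1 m.2 (d - m.1 - m.2).
Definition mono (k : 'I_nmon) := nth (0, 0)%N (layers d.+1) k.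

Lemma mono_layers k : mono k \in layers d.+1.
Proof. exact: mem_nth. Qed.


Definition form_of (u : 'rV[C]_nmon) : S := \sum_k u 0 k *: 'X_[dmon (mono k)].
Definition coefs (F : S) : 'rV[C]_nmon := \row_k F@_(dmon (mono k)).

Lemma mdeg_dmon m : m \in layers d.+1 -> mdeg (dmon m) = d.
Proof.
rewrite mem_layers mdeg3 mon0 mon1 mon2 => md.
by have : (m.1 + m.2 <= d)%N by []; move: (m.1) (m.2) => i j; lia.
Qed.

Lemma form_of_dhomog u : form_of u \is d.-homog.
Proof.
apply: rpred_sum => k _; rewrite rpredZ // dhomogX.
by apply/eqP; exact: mdeg_dmon (mono_layers k).
Qed.

Lemma form_ofK u : coefs (form_of u) = u.
Proof.
apply/rowP => k; rewrite mxE raddf_sum (bigD1 k) //= mcoeffZ mcoeffX eqxx mulr1.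
rewrite big1 ?addr0 // => l lk; rewrite mcoeffZ mcoeffX.
case: eqP => [e|]; rewrite ?mulr0 //; case/eqP: lk; apply/val_inj/eqP.
have := nth_uniq (0, 0)%N (ltn_ord l) (ltn_ord k) (layers_uniq _).
rewrite -/(mono l) -/(mono k) => <-.
have e0 := congr1 (fun m : 'X_{1..3} => m i0) e; have e1 := congr1 (fun m : 'X_{1..3} => m i1) e.
by rewrite !mon0 in e0; rewrite !mon1 in e1; case: (mono l) (mono k) e0 e1 => [? ?] [? ?] /= -> ->.
Qed.

Lemma coefsK F : F \is d.-homog -> form_of (coefs F) = F.
Proof.
move=> Fd; apply/mpolyP => m; have [md|md] := eqVneq (mdeg m) d; last first.
  by rewrite !(dhomog_nemf_coeff _ md) // form_of_dhomog.
have mL : (m i0, m i1) \in layers d.+1 by rewrite mem_layers /= -md mdeg3; lia.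
have mE : m = dmon (nth (0, 0)%N (layers d.+1) (index (m i0, m i1) (layers d.+1))).
  by rewrite nth_index // /dmon -md; apply: monE.
have ltK : (index (m i0, m i1) (layers d.+1) < nmon)%N by rewrite index_mem.
have := form_ofK (coefs F) => /rowP/(_ (Ordinal ltK)).
by rewrite !mxE /mono /= -mE.
Qed.

Lemma form_of_linear (I : finType) (c : I -> C) (u : I -> 'rV_nmon) :
  form_of (\sum_i c i *: u i) = \sum_i c i *: form_of (u i).
Proof.
under [RHS]eq_bigr do rewrite scaler_sumr.
rewrite exchange_big; apply: eq_bigr => k _; rewrite summxE scaler_suml.
by apply: eq_bigr => i _; rewrite mxE scalerA.
Qed.

(** [V] is the kernel of [A] in coefficient coordinates; the rows of a row base of [kermx A^T] give
    its basis. *)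
Lemma has_dim_rank (V : S -> Prop) r (A : 'M[C]_(r, nmon)) :
  (forall F, F \is d.-homog -> V F <-> A *m (coefs F)^T = 0) ->
  (forall F, V F -> F \is d.-homog) ->
  has_dim V (nmon - \rank A)%N.
Proof.
move=> VA Vd; rewrite -mxrank_tr -mxrank_ker.
set W := row_base (kermx A^T).
have kerE (u : 'rV_nmon) : (u <= W)%MS = (A *m u^T == 0).
  by rewrite eq_row_base; apply/sub_kermxP/eqP => [e|/(congr1 trmx)];
    [apply: trmx_inj|]; rewrite trmx_mul ?trmxK trmx0.
have VE (u : 'rV_nmon) : V (form_of u) <-> (u <= W)%MS.
  rewrite VA ?form_of_dhomog // form_ofK kerE.
  by split=> [->|/eqP].
exists (fun i => form_of (row i W)); split=> [i|]; first by rewrite VE row_sub.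
split=> [c|F FV].
  rewrite -form_of_linear => /(congr1 coefs); rewrite form_ofK.
  have -> : coefs 0 = 0 by apply/rowP => k; rewrite !mxE mcoeff0.
  have -> : \sum_i c i *: row i W = (\row_i c i) *m W.
    by rewrite mulmx_sum_row; apply: eq_bigr => i _; rewrite mxE.
  move=> /eqP; rewrite mulmx_free_eq0 ?row_base_free // => /eqP/rowP c0 i.
  by have := c0 i; rewrite !mxE.
have := FV; rewrite -{1}(coefsK (Vd _ FV)) VE => /submxP[c cE].
exists (fun i => c 0 i); rewrite -form_of_linear -mulmx_sum_row -cE.
by rewrite coefsK ?Vd.
Qed.

End Coordinates.

Section Conditions.
Variables (R : realType) (s d : nat).
Local Notation C := (CC R).
Local Notation S := {mpoly C[3]}.
Local Notation n := (6 * s + 3)%N.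
Implicit Types (v : 'I_n -> C) (F : S).

Definition line1 v k (j : 'I_3) := vget v (6 * k + j).
Definition line2 v k (j : 'I_3) := vget v (6 * k + 3 + j).

(* Two lines through [q], independent as soon as the last coordinate is nonzero. *)
Definition qline1 (q : 'I_3 -> C) (j : 'I_3) := nth 0 [:: q i2; 0; - q i0] j.
Definition qline2 (q : 'I_3 -> C) (j : 'I_3) := nth 0 [:: 0; q i2; - q i1] j.

(** Exponents of X and Y outside (X^2, Y^2) and, for [fat_exp], outside (X, Y)^3. *)
Definition sq_exp c := nth (0, 0)%N [:: (0, 0); (1, 0); (0, 1); (1, 1)]%N c.
Definition fat_exp c := nth (0, 0)%N (layers 3) c.

(* Row r < 4s is the condition number r mod 4 of the 2-square r / 4; the six
   remaining rows are the conditions of the triple point. *)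
Definition row_line1 v r (j : 'I_3) :=
  if (r < 4 * s)%N then line1 v (r %/ 4) j else qline1 (Qof s v) j.
Definition row_line2 v r (j : 'I_3) :=
  if (r < 4 * s)%N then line2 v (r %/ 4) j else qline2 (Qof s v) j.
Definition row_exp r :=
  if (r < 4 * s)%N then sq_exp (r %% 4) else fat_exp (r - 4 * s).

Definition cond v r F : C :=
  (psi (row_line1 v r) (row_line2 v r) F)@_(dmon d (row_exp r)).

Definition condmx v : 'M[C]_(4 * s + 6, nmon d) :=
  \matrix_(r, k) cond v r 'X_[dmon d (mono k)].

Lemma condmxE v F (r : 'I_(4 * s + 6)) : F \is d.-homog ->
  (condmx v *m (coefs d F)^T) r 0 = cond v r F.
Proof.
move=> Fd; rewrite -{2}(coefsK Fd) /cond /psi /form_of mxE.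
rewrite (raddf_sum (comp_mpoly _)) (raddf_sum (mcoeff _)) /=.
by apply: eq_bigr => k _; rewrite !mxE comp_mpolyZ mcoeffZ mulrC.
Qed.

Lemma psi_ext (a b a' b' : 'I_3 -> C) F : a =1 a' -> b =1 b' -> psi a b F = psi a' b' F.
Proof.
move=> aa' bb'; rewrite /psi (_ : psi_subst a b = psi_subst a' b') //.
by rewrite /psi_subst /meet_x /meet_y /meet_z !aa' !bb'.
Qed.

Lemma cond_square v k c F : (k < s)%N -> (c < 4)%N ->
  cond v (4 * k + c) F = (psi (line1 v k) (line2 v k) F)@_(dmon d (sq_exp c)).
Proof.
move=> ks c4; rewrite /cond; have lt4 : (4 * k + c < 4 * s)%N by lia.
have kE : ((4 * k + c) %/ 4 = k)%N by lia.
have cE : ((4 * k + c) %% 4 = c)%N by lia.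
rewrite /row_exp lt4 cE (@psi_ext _ _ (line1 v k) (line2 v k)) // => j;
  by rewrite /row_line1 /row_line2 lt4 kE.
Qed.

Lemma cond_triple v c F :
  cond v (4 * s + c) F =
  (psi (qline1 (Qof s v)) (qline2 (Qof s v)) F)@_(dmon d (fat_exp c)).
Proof.
rewrite /cond /row_exp ltnNge leq_addr /= addKn.
rewrite (@psi_ext _ _ (qline1 (Qof s v)) (qline2 (Qof s v))) // => j;
  by rewrite /row_line1 /row_line2 ltnNge leq_addr.
Qed.

(** In degree 1 some exponents of the conditions do not fit. By truncated subtraction [dmon] then
    has degree greater than [d], and the condition is vacuous. *)
Lemma mcoeff_over F m : F \is d.-homog -> m \notin layers d.+1 -> F@_(dmon d m) = 0.
Proof.
move=> Fd; rewrite mem_layers => md; apply: (dhomog_nemf_coeff Fd).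
by apply/eqP => /=; rewrite mdeg3 mon0 mon1 mon2; move: md; case: m => i j /=; lia.
Qed.

(** Each ideal is read off in its own frame; the two frame lines of the triple point meet at [q i2]
    times q, whence the constant used for it. *)
Lemma IX_dP v F :
  (forall i, (i < s)%N -> meet_z (line1 v i) (line2 v i) != 0) -> Qof s v i2 != 0 ->
  F \is d.-homog -> IX_d s d v F <-> condmx v *m (coefs d F)^T = 0.
Proof.
move=> zs q2 Fd; set q := Qof s v in q2 *.
have zq : meet_z (qline1 q) (qline2 q) != 0.
  by rewrite /meet_z /qline1 /qline2 /= mul0r subr0 mulf_neq0.
have qP : [/\ meet_x (qline1 q) (qline2 q) = q i2 * q i0,
    meet_y (qline1 q) (qline2 q) = q i2 * q i1 &
    meet_z (qline1 q) (qline2 q) = q i2 * q i2].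
  by rewrite /meet_x /meet_y /meet_z /qline1 /qline2 /=; split; ring.
have q1 : \sum_(i < 3) qline1 q i * q i = 0 by rewrite big_ord3 /qline1 /=; ring.
have q2' : \sum_(i < 3) qline2 q i * q i = 0 by rewrite big_ord3 /qline2 /=; ring.
have dmonE (m : 'X_{1..3}) : mdeg m = d -> m = dmon d (m i0, m i1).
  by move=> <-; apply: monE.
split=> [[_ [sqF trF]]|F0].
  apply/matrixP => r j; rewrite ord1 condmxE // mxE.
  have [lt4|ge4] := ltnP r (4 * s).
    have ks : (r %/ 4 < s)%N by lia.
    rewrite (_ : nat_of_ord r = 4 * (r %/ 4) + r %% 4)%N; last first.
      by have := divn_eq r 4; rewrite [(_ %/ _ * _)%N]mulnC.
    rewrite cond_square ?ltn_mod //.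
    have := (in_I_2squareP Fd (zs _ ks)).1 (sqF _ ks) => Fsq.
    have [mL|mL] := boolP (sq_exp (r %% 4) \in layers d.+1); last first.
      by rewrite mcoeff_over // psi_dhomog.
    apply: Fsq; last exact: mdeg_dmon.
      by rewrite mon0; have := ltn_pmod r (isT : 0 < 4)%N; case: (_ %% _)%N => [|[|[|[|]]]].
    by rewrite mon1; have := ltn_pmod r (isT : 0 < 4)%N; case: (_ %% _)%N => [|[|[|[|]]]].
  rewrite (_ : nat_of_ord r = 4 * s + (r - 4 * s))%N; last by rewrite subnKC.
  have c6 : (r - 4 * s < size (layers 3))%N by rewrite -[size _]/6%N; have := ltn_ord r; lia.
  rewrite cond_triple -/q; have := (in_I_tripleP Fd zq qP q1 q2').1 trF => Ftr.
  have [mL|mL] := boolP (fat_exp (r - 4 * s) \in layers d.+1); last first.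
    by rewrite mcoeff_over // psi_dhomog.
  apply: Ftr; last exact: mdeg_dmon.
  by rewrite mon0 mon1 -ltnS -mem_layers mem_nth.
have F0' r : (r < 4 * s + 6)%N -> cond v r F = 0.
  move=> ltr; have := condmxE v (Ordinal ltr) Fd; rewrite F0 mxE => <- //.
split=> //; split=> [i ltis|].
  apply/(in_I_2squareP Fd (zs _ ltis)) => m m0 m1 md.
  have [c c4 cE] : exists2 c, (c < 4)%N & sq_exp c = (m i0, m i1).
    by case: (m i0) (m i1) m0 m1 => [|[|]] // [|[|]] // _ _;
      [exists 0%N | exists 2%N | exists 1%N | exists 3%N].
  by rewrite (dmonE m md) -cE -cond_square // F0' //; lia.
apply/(in_I_tripleP Fd zq qP q1 q2') => m m2 md.
have mL : (m i0, m i1) \in layers 3 by rewrite mem_layers.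
rewrite (dmonE m md) -(nth_index (0, 0)%N mL) -/(fat_exp _) -cond_triple F0' //.
by rewrite ltn_add2l -[6%N]/(size (layers 3)) index_mem.
Qed.

Lemma polyfun_condmx r k : polyfun (fun v => condmx v r k).
Proof.
have pq i : polyfun (fun v => Qof s v i) by apply: polyfun_vget.
have p0 : @polyfun R n (fun=> 0) by apply: polyfun_const.
have [H HE] : polyfun (fun v => cond v r 'X_[dmon d (mono k)]).
  apply: (@polyfam_psi R n (fun v => row_line1 v r) (fun v => row_line2 v r)) => j;
  rewrite /row_line1 /row_line2; case: (r < _)%N; try exact: polyfun_vget.
    by move: j; apply: forall_ord3; rewrite /qline1 /=; try exact: polyfunN.
  by move: j; apply: forall_ord3; rewrite /qline2 /=; try exact: polyfunN.
by exists H => v; rewrite mxE HE.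
Qed.

Lemma polyfun_meet_z i : polyfun (fun v => meet_z (line1 v i) (line2 v i)).
Proof. by apply: polyfunB; apply: polyfunM; apply: polyfun_vget. Qed.

End Conditions.

(** Semicontinuity of the rank: constant matrices [E] and [G] turn [M v0] into an identity matrix of
    size its rank. The determinant of [E *m M v *m G] is polynomial in v and nonzero at v0, and
    wherever it is nonzero the rank is at least that of [M v0]. *)
Lemma general_rank (R : realType) n r k (M : ('I_n -> CC R) -> 'M[CC R]_(r, k)) v0 :
  (forall i j, polyfun (fun v => M v i j)) ->
  general_prop (fun v => (\rank (M v0) <= \rank (M v))%N).
Proof.
move=> pM; pose E := (pinvmx (col_base (M v0))^T)^T.
pose G := pinvmx (row_base (M v0)).
have EG : E *m M v0 *m G = 1%:M.
  have <- := congr1 (fun X => E *m X *m G) (mulmx_base (M v0)).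
  rewrite mulmxA -mulmxA /G mulmxVp ?row_base_free // mulmx1 /E.
  apply: trmx_inj; rewrite trmx_mul trmxK mulmxVp ?trmx1 //.
  by rewrite -row_leq_rank mxrank_tr; have := col_base_full (M v0); rewrite /row_full => /eqP->.
have pd : polyfun (fun v => \det (E *m M v *m G)).
  apply: polyfun_det; apply: polyfun_mulmx; last by move=> *; apply: polyfun_const.
  by apply: polyfun_mulmx => // *; apply: polyfun_const.
apply: general_imp (general_neq0 (v0 := v0) pd _); last by rewrite EG det1 oner_neq0.
move=> v dv; have u : E *m M v *m G \in unitmx by rewrite unitmxE unitfE.
rewrite -{1}(mxrank_unit u); apply: leq_trans (mxrankM_maxl _ _) _; exact: mxrankM_maxr.
Qed.

(** * The special configuration *)

Lemma sum_delta (F : pzRingType) N c (g : nat -> F) :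
  ((N <= c)%N -> g c = 0) -> \sum_(u < N) g u * (u == c :> nat)%:R = g c.
Proof.
move=> gc; have [cN|Nc] := ltnP c N.
  rewrite (bigD1 (Ordinal cN)) //= eqxx mulr1 big1 ?addr0 // => u uc.
  by rewrite -[(u == c :> nat)]/(u == Ordinal cN) (negPf uc) mulr0.
rewrite gc // big1 // => u _; rewrite ltn_eqF ?mulr0 //.
exact: leq_trans (ltn_ord u) Nc.
Qed.

Section SpecialConfiguration.
Variables (R : realType) (s d : nat).
Local Notation C := (CC R).
Local Notation n := (6 * s + 3)%N.
Variables (p q : nat -> C).

(* The 2-squares are cut out by (X - p_k Z)^2, (Y - q_k Z)^2 and Q = [0 : 0 : 1]. *)
Definition special (i : 'I_n) : C :=
  if (i < 6 * s)%N then nth 0 [:: 1; 0; - p (i %/ 6); 0; 1; - q (i %/ 6)] (i %% 6)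
  else nth 0 [:: 0; 0; 1] (i - 6 * s).

Lemma vget_special k j : (k < s)%N -> (j < 6)%N ->
  vget special (6 * k + j) = nth 0 [:: 1; 0; - p k; 0; 1; - q k] j.
Proof.
move=> ks j6; have ltn : (6 * k + j < n)%N by lia.
have kE : ((6 * k + j) %/ 6 = k)%N by lia.
have jE : ((6 * k + j) %% 6 = j)%N by lia.
rewrite /vget insubT /special /= kE jE ifT //; lia.
Qed.

Lemma Qof_special j : Qof s special j = nth 0 [:: 0; 0; 1] j.
Proof.
have ltn : (6 * s + j < n)%N by rewrite ltn_add2l.
by rewrite /Qof /vget insubT /special /= ltnNge leq_addr addKn.
Qed.

(** For these lines [psi] substitutes X + x Z and Y + y Z for X and Y, so the binomial theorem gives
    the Taylor coefficients at (x, y). *)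
Lemma psi_affine (a b : 'I_3 -> C) (x y : C) i j l (m : nat * nat) :
  a i0 = 1 -> a i1 = 0 -> a i2 = - x -> b i0 = 0 -> b i1 = 1 -> b i2 = - y ->
  (m.1 + m.2 <= i + j + l)%N ->
  (psi a b 'X_[mon i j l])@_(dmon (i + j + l) m) =
  'C(i, m.1)%:R * 'C(j, m.2)%:R * x ^+ (i - m.1) * y ^+ (j - m.2).
Proof.
move=> a0 a1 a2 b0 b1 b2 md.
rewrite /psi comp_mpolyX big_ord3 !(tnth_nth 0) /= mon0 mon1 mon2.
rewrite /meet_x /meet_y /meet_z a0 a1 a2 b0 b1 b2.
set X0 := 'X_i0; set X1 := 'X_i1; set X2 := 'X_i2.
rewrite (_ : _ *: X0 - _ + _ = x *: X2 + X0); last first.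
  by rewrite -!mul_mpolyC !(rmorphB, rmorphM, rmorphN, rmorph0, rmorph1) /=; ring.
rewrite (_ : _ *: X1 - _ + _ = y *: X2 + X1); last first.
  by rewrite -!mul_mpolyC !(rmorphB, rmorphM, rmorphN, rmorph0, rmorph1) /=; ring.
rewrite mulr1 mulr0 subr0 scale1r !exprDn big_distrlr /= big_distrl /=.
rewrite (raddf_sum (mcoeff _)) /=.
transitivity (\sum_(u < i.+1) ('C(i, u)%:R * x ^+ (i - u) *
    ('C(j, m.2)%:R * y ^+ (j - m.2))) * (u == m.1 :> nat)%:R); last first.
  rewrite (@sum_delta _ _ _ (fun u => 'C(i, u)%:R * x ^+ (i - u) *
    ('C(j, m.2)%:R * y ^+ (j - m.2)))) => [|im]; first by ring.
  by rewrite bin_small // !mul0r.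
apply: eq_bigr => u _; rewrite big_distrl (raddf_sum (mcoeff _)) /=.
rewrite -(@sum_delta _ j.+1 _ (fun w => 'C(j, w)%:R * y ^+ (j - w))) => [|jm]; last first.
  by rewrite bin_small // mul0r.
rewrite mulr_sumr mulr_suml; apply: eq_bigr => w _.
have -> : (x *: X2) ^+ (i - u) * X0 ^+ u *+ 'C(i, u) *
   ((y *: X2) ^+ (j - w) * X1 ^+ w *+ 'C(j, w)) * X2 ^+ l =
   ('C(i, u)%:R * x ^+ (i - u) * ('C(j, w)%:R * y ^+ (j - w))) *:
   'X_[mon u w ((i - u) + (j - w) + l)].
  rewrite mpolyXE_id big_ord3 /= mon0 mon1 mon2 -/X0 -/X1 -/X2 !exprD !exprZn.
  rewrite -[_ *+ 'C(i, u)]scaler_nat -[_ *+ 'C(j, w)]scaler_nat.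
  by rewrite -!mul_mpolyC !rmorphM /=; ring.
rewrite mcoeffZ mcoeffX -!mulrA; congr (_ * (_ * (_ * (_ * _)))).
rewrite -natrM mulnb; congr (_%:R); congr (nat_of_bool _).
have ui := ltn_ord u; have wj := ltn_ord w.
apply/eqP/andP => [e|[/eqP wm /eqP um]].
  have e0 := congr1 (fun m : 'X_{1..3} => m i0) e.
  have e1 := congr1 (fun m : 'X_{1..3} => m i1) e.
  by rewrite !mon0 in e0; rewrite !mon1 in e1; rewrite e0 e1.
rewrite /dmon -um -wm; congr (mon _ _ _); lia.
Qed.

End SpecialConfiguration.

Section SpecialRank.
Variables (R : realType) (s d : nat).
Local Notation C := (CC R).
Variables (p q : nat -> C).
Hypothesis pq0 : forall k, p k != 0 /\ q k != 0.
Local Notation v0 := (@special R s p q).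

Lemma dmon_sum (m : nat * nat) : m \in layers d.+1 -> (m.1 + m.2 + (d - m.1 - m.2) = d)%N.
Proof. by rewrite mem_layers ltnS => md; rewrite -subnDA subnKC. Qed.

Lemma cond_special_square k c (m : nat * nat) : (k < s)%N -> (c < 4)%N -> m \in layers d.+1 ->
  p k ^+ (sq_exp c).1 * q k ^+ (sq_exp c).2 * cond d v0 (4 * k + c) 'X_[dmon d m] =
  jet C c m * p k ^+ m.1 * q k ^+ m.2.
Proof.
move=> ks c4 mL; rewrite cond_square //.
have bin1E (z : C) i : z * ('C(i, 1)%:R * z ^+ (i - 1)) = i%:R * z ^+ i.
  by case: i => [|i]; rewrite ?bin1 ?mul0r ?mulr0 // subn1 exprS mulrCA.
(* If the exponent of the condition does not fit in degree d, the jet factor also vanishes at every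
   point with i + j <= d. *)
have [cL|cL] := boolP (sq_exp c \in layers d.+1); last first.
  rewrite mcoeff_over ?psi_dhomog ?dhomogX /= ?mdeg_dmon ?mulr0 //.
  move: mL cL; rewrite !mem_layers; case: m => i j.
  case: c c4 => [|[|[|[|//]]]] _ /=; rewrite /jet /=; case: i j => [|[|i]] [|[|j]] //= ;
    rewrite ?mulr0 ?mul0r //; lia.
have := @psi_affine R (line1 v0 k) (line2 v0 k) (p k) (q k) m.1 m.2 (d - m.1 - m.2) (sq_exp c).
rewrite dmon_sum // => ->.
- have assoc (A B X Y P Q : C) : A * B * (X * Y * P * Q) = (A * (X * P)) * (B * (Y * Q)).
    by ring.
  have bin0E (z : C) i : z ^+ 0 * ('C(i, 0)%:R * z ^+ (i - 0)) = z ^+ i.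
    by rewrite expr0 bin0 subn0 !mul1r.
  rewrite assoc; case: c c4 {cL} => [|[|[|[|//]]]] _; rewrite /jet /= ?expr1 ?bin0E ?bin1E;
    ring.
all: rewrite ?/line1 ?/line2 -?addnA ?vget_special //.
by have := cL; rewrite mem_layers.
Qed.

Lemma cond_special_triple c (m : nat * nat) :
  fat_exp c \in layers d.+1 -> m \in layers d.+1 ->
  cond d v0 (4 * s + c) 'X_[dmon d m] = (m == fat_exp c)%:R.
Proof.
move=> cL mL; rewrite cond_triple.
have := @psi_affine R (qline1 (Qof s v0)) (qline2 (Qof s v0)) 0 0
  m.1 m.2 (d - m.1 - m.2) (fat_exp c).
rewrite dmon_sum // => ->; rewrite /qline1 /qline2 ?Qof_special ?oppr0 //; last first.
  by have := cL; rewrite mem_layers.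
case: m (fat_exp c) mL {cL} => [i j] [i' j'] _ /=; rewrite -pair_eqE /= !expr0n.
have delta a b : 'C(a, b)%:R * (a - b == 0)%N%:R = (a == b)%:R :> C.
  rewrite subn_eq0; case: ltngtP => [ab|ba|->]; rewrite ?mulr0 ?binn ?mulr1 //.
  by rewrite bin_small // mul0r.
by rewrite -mulrA mulrACA !delta -natrM mulnb.
Qed.

Definition rows_span (y : nat * nat -> C) :=
  exists e : 'rV_(4 * s + 6), forall k, y (mono k) = (e *m condmx d v0) 0 k.

Lemma rows_span_closed : lin_closed rows_span.
Proof.
split=> [y z yz [e ye]||c y z [e ye] [f zf]].
- by exists e => k; rewrite -yz.
- by exists 0 => k; rewrite mul0mx mxE.
by exists (c *: e + f) => k; rewrite mulmxDl -scalemxAl !mxE ye zf !mxE.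
Qed.

Lemma rows_span_cond (r : nat) c y : (r < 4 * s + 6)%N ->
  (forall m, m \in layers d.+1 -> y m = c * cond d v0 r 'X_[dmon d m]) -> rows_span y.
Proof.
move=> ltr yE; exists (c *: delta_mx 0 (Ordinal ltr)) => k.
by rewrite yE ?mono_layers // -scalemxAl -rowE !mxE.
Qed.

Lemma rows_span_jets y : jets p q s y -> rows_span y.
Proof.
have [span_ext _ _] := rows_span_closed.
case=> e ye; apply: (span_ext _ _ (fun m => esym (ye m))).
apply: (span_ext (fun m => \sum_(k < s) 1 * \sum_(c < 4) e k c *
    (jet C c m * p k ^+ m.1 * q k ^+ m.2))).
  by move=> m; apply: eq_bigr => k _; rewrite mul1r.
apply: (lin_closed_sum _ (y := fun (k : 'I_s) m => \sum_(c < 4) e k c *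
  (jet C c m * p k ^+ m.1 * q k ^+ m.2))) rows_span_closed _ => k.
apply: (lin_closed_sum _ (y := fun (c : 'I_4) m =>
  (jet C c m * p k ^+ m.1 * q k ^+ m.2))) rows_span_closed _ => c.
have ks := ltn_ord k; have c4 := ltn_ord c.
apply: (@rows_span_cond (4 * k + c) (p k ^+ (sq_exp c).1 * q k ^+ (sq_exp c).2)).
  by lia.
by move=> m mL; rewrite cond_special_square.
Qed.

Lemma rank_ge_condmx r : rank_ge (layers d.+1) rows_span r -> (r <= \rank (condmx d v0))%N.
Proof.
case=> u [x [us ux]]; have [e eE] := fin_all_exists us.
pose U := \matrix_(i, k) u i (mono k) : 'M[C]_(r, nmon d).
pose X := \matrix_(k, j) x j (mono k) : 'M[C]_(nmon d, r).
have UX : U *m X = 1%:M.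
  apply/matrixP => i j; rewrite !mxE -ux (big_nth (0, 0)%N) big_mkord.
  by apply: eq_bigr => k _; rewrite !mxE.
have -> : r = \rank (U *m X) by rewrite UX mxrank1.
apply: leq_trans (mxrankM_maxl _ _) _.
have -> : U = (\matrix_i e i) *m condmx d v0.
  by apply/row_matrixP => i; rewrite row_mul rowK; apply/rowP => k; rewrite -eE !mxE.
exact: mxrankM_maxr.
Qed.

(** The conditions of the triple point at [0 : 0 : 1] give the indicators of the points of [T].
    These vanish on [D], so the Schur complement is the identity. *)
Lemma rank_special D T r :
  perm_eq (T ++ D) (layers d.+1) -> {subset T <= layers 3} ->
  rank_ge D (jets p q s) r -> (size T + r <= \rank (condmx d v0))%N.
Proof.
move=> TD T3 rk; apply: rank_ge_condmx; apply: (rank_ge_perm TD).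
have uTD : uniq (in_tuple T ++ D) by rewrite (perm_uniq TD) layers_uniq.
have [h hP] := rank_ge_extend uTD rk.
apply: (hP rows_span (fun a m => (m == tnth (in_tuple T) a)%:R)).
- exact: rows_span_closed.
- exact: rows_span_jets.
- move=> a; set t := tnth _ a; have tT : t \in T by rewrite -[T]/(val (in_tuple T)) mem_tnth.
  have t3 := T3 _ tT.
  have tE : fat_exp (index t (layers 3)) = t by apply: nth_index.
  apply: (@rows_span_cond (4 * s + index t (layers 3)) 1).
    by rewrite ltn_add2l -[6%N]/(size (layers 3)) index_mem.
  move=> m mL; rewrite mul1r cond_special_triple ?tE //.
  by rewrite -(perm_mem TD) mem_cat tT.
rewrite (_ : \matrix_(a, j) _ = 1%:M) ?det1 ?oner_neq0 //.
apply/matrixP => a j; rewrite !mxE big1_seq ?subr0 => [|m /andP[_ mD]].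
  by move: uTD; rewrite cat_uniq => /andP[/tuple_uniqP uT _]; rewrite (inj_eq uT) eq_sym.
case: eqP => [mE|_]; rewrite ?mul0r //; move: uTD; rewrite cat_uniq => /and3P[_ /hasPn/(_ _ mD)].
by rewrite mE mem_tnth.
Qed.

End SpecialRank.

(** In the exceptional case the ten conditions on the ten cubic monomials have rank only 9. *)
Definition expected_rank s d :=
  if (s == 1)%N && (d == 3)%N then 9%N else minn (4 * s + 6) 'C(d.+2, 2).

Lemma special_rank_ge (R : realType) s d : (1 <= s)%N -> (1 <= d)%N ->
  exists p q : nat -> CC R, (forall k, p k != 0 /\ q k != 0) /\
    (expected_rank s d <= \rank (condmx d (@special R s p q)))%N.
Proof.
move=> s1 d1; rewrite /expected_rank.
have from_jets T D r : perm_eq (T ++ D) (layers d.+1) -> {subset T <= layers 3} ->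
    jets_rank_ge (CC R) D s r -> exists p q : nat -> CC R,
    (forall k, p k != 0 /\ q k != 0) /\
    (size T + r <= \rank (condmx d (@special R s p q)))%N.
  move=> TD T3 [p [q [pq rk]]]; exists p, q; split=> //; exact: rank_special rk.
case: d d1 from_jets => [|[|n]] // _ from_jets.
  (* In degree 1 the triple point alone accounts for all three monomials. *)
  have [] := from_jets (layers 2) [::] 0%N; rewrite ?cats0 ?andbF //.
  - by move=> m; rewrite !mem_layers => /leq_trans; apply.
  - exact: jets_rank_ge0.
  move=> p [q [pq rk]]; exists p, q; split=> //.
  by rewrite (leq_trans _ rk) // geq_min orbT.
have upper r : jets_rank_ge (CC R) (upper_layers n) s r -> exists p q : nat -> CC R,
    (forall k, p k != 0 /\ q k != 0) /\
    (6 + r <= \rank (condmx n.+2 (@special R s p q)))%N.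
  apply: (from_jets (layers 3)) => //.
  by rewrite perm_catC -layers_upper addn3.
have le r1 r2 : (r1 <= r2)%N -> (exists p q : nat -> CC R,
    (forall k, p k != 0 /\ q k != 0) /\
    (r2 <= \rank (condmx n.+2 (@special R s p q)))%N) -> exists p q : nat -> CC R,
    (forall k, p k != 0 /\ q k != 0) /\
    (r1 <= \rank (condmx n.+2 (@special R s p q)))%N.
  by move=> r12 [p [q [pq rk]]]; exists p, q; split=> //; apply: leq_trans rk.
(* Degree 2 has only the triple point's monomials. In degree 3 one 2-square gives rank 3 on layer 3
   and two give rank 4. From degree 4 on the rank is maximal. *)
case: n {from_jets} upper le => [|[|n]] upper le.
- rewrite andbF; apply: le (upper 0%N (jets_rank_ge0 _ _ _)).
  by rewrite geq_min orbT.
- case: s s1 upper le => [|[|s]] // _ upper le.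
    apply: le (upper 3%N _) => //; rewrite -[upper_layers 1]/(seg 3 4 ++ [::]) cats0.
    by apply: (@jets_rank_ge_seg _ 3 1 3 0 0) => //; apply: jets_rank_ge0.
  by apply: le (upper 4%N (@jets_rank_ge_cubics _ _)); rewrite geq_min orbT.
rewrite andbF; apply: le (upper _ (@max_rank_upper_layers _ n.+2 isT s)).
by rewrite -size_upper_layers addn_minr addnC [(6 + size _)%N]addnC.
Qed.

(** * The unexpected cubic *)

Section TripleLine.
Variable R : realType.
Local Notation C := (CC R).

Lemma mcoeff_linform (a : 'I_3 -> C) j : (linform a)@_U_(j) = a j.
Proof.
rewrite /linform raddf_sum (bigD1 j) //= mcoeffZ mcoeffXU eqxx mulr1 big1 ?addr0 //.
by move=> i ij; rewrite mcoeffZ mcoeffXU (negPf ij) mulr0.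
Qed.

Lemma lin_indep2_linform (a b : 'I_3 -> C) : meet_z a b != 0 ->
  lin_indep2 (linform a) (linform b).
Proof.
move=> z0 x y xy0.
have e j : x * a j + y * b j = 0.
  by have := congr1 (mcoeff U_(j)) xy0; rewrite mcoeffD !mcoeffZ !mcoeff_linform mcoeff0.
split; apply: (mulIf z0); rewrite mul0r /meet_z.
  transitivity ((x * a i0 + y * b i0) * b i1 - (x * a i1 + y * b i1) * b i0); first by ring.
  by rewrite !e !mul0r subrr.
transitivity ((x * a i1 + y * b i1) * a i0 - (x * a i0 + y * b i0) * a i1); first by ring.
by rewrite !e !mul0r subrr.
Qed.

Definition eval_line (a q : 'I_3 -> C) := \sum_(i < 3) a i * q i.

Lemma eval_lineE a q t : (linform a).@[fun i => t * q i] = t * eval_line a q.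
Proof.
rewrite /linform raddf_sum /= mulr_sumr.
by apply: eq_bigr => i _; rewrite mevalZ mevalXU mulrCA.
Qed.

(* Every cubic form in [linform a] and [linform b] lies in the ideal of their squares:
   take the cube of the one that vanishes at [q]. *)
Lemma triple_line (a b q : 'I_3 -> C) : meet_z a b != 0 -> eval_line b q != 0 ->
  exists F, [/\ F != 0, F \is 3.-homog, in_I_2square (linform a) (linform b) F
    & in_I_triple q F].
Proof.
move=> z0 bq; set A := linform a; set B := linform b.
set x := eval_line b q in bq *; pose y := eval_line a q.
pose L := x *: A - y *: B.
have homog1 (c : 'I_3 -> C) : linform c \is 1.-homog.
  by apply: rpred_sum => i _; rewrite rpredZ // dhomogX /= mdeg1.
have Lh : L \is 1.-homog by rewrite rpredB ?rpredZ ?homog1.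
exists (L ^+ 3); split.
- rewrite expf_neq0 //; apply/eqP => L0.
  have /(lin_indep2_linform z0)[x0 _] : x *: A + (- y) *: B = 0 by rewrite scaleNr.
  by rewrite x0 eqxx in bq.
- exact: (dhomogMn 3 Lh).
(* Binomial expansion of the cube, with A^3 and A^2 B grouped under A^2 and the other two terms
   under B^2. *)
- exists (x ^+ 3 *: A - (3 * x ^+ 2 * y) *: B), ((3 * x * y ^+ 2) *: A - y ^+ 3 *: B).
  by rewrite /L -!mul_mpolyC !(rmorphM, rmorphXn, rmorph_nat) /=; ring.
exists 1%N, (fun=> L), (fun=> L), (fun=> L); split; last first.
  by rewrite big_ord1 !exprS expr0 mulr1 mulrA.
suff LQ : in_I_point q L by [].
by move=> t; rewrite /L mevalB !mevalZ !eval_lineE -/x -/y; ring.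
Qed.

End TripleLine.

Theorem theorem4p1 (R : realType) (s d : nat) :
  (1 <= s)%N -> (1 <= d)%N ->
  general_prop (n := 6 * s + 3) (fun v : 'I_(6 * s + 3) -> CC R =>
    (forall i, (i < s)%N -> lin_indep2 (L1of v i) (L2of v i)) /\
    (exists j, Qof s v j != 0) /\
    has_dim (IX_d s d v)
      (if (s == 1%N) && (d == 3%N) then 1%N else ('C(d.+2, 2) - (4 * s + 6))%N)).
Proof.
move=> s1 d1; have [p [q [pq rk0]]] := @special_rank_ge R s d s1 d1.
set v0 := special p q in rk0.
(* The supports of the 2-squares, and then Q, are kept off the line Z = 0, so that the frames are
   invertible. *)
have gz : general_prop (fun v : 'I_(6 * s + 3) -> CC R =>
    forall i, (i < s)%N -> meet_z (line1 v i) (line2 v i) != 0).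
  apply: general_forall => i ltis; apply: (general_neq0 (v0 := v0)).
    exact: polyfun_meet_z.
  rewrite /meet_z /line1 /line2 -!addnA !vget_special //= mulr0 subr0 mulr1.
  exact: oner_neq0.
have gq : general_prop (fun v : 'I_(6 * s + 3) -> CC R => Qof s v i2 != 0).
  apply: (general_neq0 (v0 := v0)); first exact: polyfun_vget.
  by rewrite Qof_special oner_neq0.
(* Q off the second line of the first 2-square, as [triple_line] demands; at the special
   configuration the value is [- q 0]. *)
have gl : general_prop (fun v : 'I_(6 * s + 3) -> CC R =>
    eval_line (line2 v 0) (Qof s v) != 0).
  apply: (general_neq0 (v0 := v0)).
    by apply: polyfun_sum => i; apply: polyfunM; apply: polyfun_vget.
  rewrite /eval_line big_ord3 !Qof_special /line2 -!addnA !vget_special //=.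
  by rewrite !mulr0 !add0r mulr1 oppr_eq0; have [] := pq 0%N.
have gr := general_rank v0 (@polyfun_condmx R s d).
apply: general_imp (general_and gz (general_and gq (general_and gl gr))).
move=> v [zs [q2 [lq rkv]]]; split; last split.
- by move=> i ltis; apply: lin_indep2_linform; apply: zs.
- by exists i2.
have VA F : F \is d.-homog -> IX_d s d v F <-> condmx d v *m (coefs d F)^T = 0.
  exact: IX_dP.
have rk : \rank (condmx d v) = expected_rank s d.
  apply/eqP; rewrite eqn_leq (leq_trans rk0 rkv) andbT /expected_rank.
  case: ifP => [/andP[/eqP sE /eqP dE]|_]; last first.
    by rewrite leq_min rank_leq_row -size_layers rank_leq_col.
  subst s d; have [F [F0 Fh Fsq Ftr]] := triple_line (zs 0%N isT) lq.
  (* Rank 10 would make this matrix with ten columns injective on cubics, against the nonzero cubic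
     [F] in its kernel. *)
  rewrite -ltnS ltn_neqAle rank_leq_row andbT; apply/negP => /eqP rk10.
  have free : row_free (condmx 3 v)^T by rewrite /row_free mxrank_tr rk10.
  case/eqP: F0; rewrite -(coefsK Fh).
  have : condmx 3 v *m (coefs 3 F)^T = 0.
    apply/(VA F Fh); split; first exact: Fh.
    by split; [case=> [_|i]; [exact: Fsq|rewrite ltnS ltn0] | exact: Ftr].
  move/(congr1 trmx); rewrite trmx_mul trmxK trmx0 => /eqP.
  rewrite mulmx_free_eq0 // => /eqP ->.
  by rewrite /form_of big1 // => k _; rewrite mxE scale0r.
(* Truncated subtraction is the maximum with 0; in the exceptional case 10 - 9 = 1. *)
have -> : (if (s == 1%N) && (d == 3%N) then 1%N else 'C(d.+2, 2) - (4 * s + 6))%N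
    = (nmon d - \rank (condmx d v))%N.
  rewrite rk /expected_rank /nmon size_layers.
  by case: ifP => [/andP[_ /eqP->] //|_]; rewrite minnC; lia.
by apply: has_dim_rank => // F [].
Qed.
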